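(* Let $(\mathcal X,d)$ be a compact metric space, $\mathcal Y$ a finite set with $m=\#\mathcal Y$, and $\ell:\mathcal Y\times\mathcal Y\to\mathbb R$ a proper loss, i.e. $\ell(y,y)=0$ and $\ell(z,y)>0$ for $z\neq y$. Let $\nu$ be a probability distribution on $\mathcal X\times 2^{\mathcal Y}$ with marginal $\nu_{\mathcal X}$ on $\mathcal X$, and let $\mu^*$, $f^*$, $g^*$, $\phi$, $\psi$, $c_\phi$, $c_\psi$, $\mathcal R$ and the estimator $f_n$ be as in the context, where $f_n$ is built from a sample $\mathcal D_n=(X_i,S_i)_{i\le n}\sim\nu^{\otimes n}$ using the $k$-nearest-neighbor weights. Assume: (1) there exist $h_1,c_\mu,q>0$ such that $\nu_{\mathcal X}(\mathcal B(x,r))>c_\mu r^q$ for all $x\in\operatorname{supp}\nu_{\mathcal X}$ and all $0<r<h_1$, where $\mathcal B(x,r)$ is the ball of center $x$ and radius $r$ in $\mathcal X$; (2) there exists $\eta\in[0,1)$ such that for every $x\in\operatorname{supp}\nu_{\mathcal X}$ there is $y_x\in\mathcal Y$ with $\mathbb P_\nu(y_x\in S\mid X=x)=1$ and $\mathbb P_\nu(z\in S\mid X=x)\le\eta$ for every $z\neq y_x$; (3) there exists $c_g>0$ such that $\|g^*(x)-g^*(x')\|_{\mathcal H}\le c_g\,d(x,x')$ for all $x,x'\in\mathcal X$. Let $h_2>0$ be such that $d(x,x')>h_2$ whenever $x,x'\in\operatorname{supp}\nu_{\mathcal X}$ satisfy $f^*(x)\neq f^*(x')$ (such an $h_2$ exists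 under (2) and (3)), and set $h=\min(h_1,h_2)$ and $p=c_\mu h^q$. Then, as soon as $k<np/4$, $$\mathbb E_{\mathcal D_n}[\mathcal R(f_n)]-\mathcal R(f^* )\;\le\;8c_\psi c_\phi\,(n+1)\exp\Big(-\frac{np}{16}\Big)+8c_\psi c_\phi\, m\exp\big(-k|\log(\eta)|\big).$$ By taking $k=k_n=k_0n$ with $k_0<p/4$, this implies exponential convergence rates $$\mathbb E_{\mathcal D_n}[\mathcal R(f_n)]-\mathcal R(f^* )=O(n\exp(-n)).$$
   Context: Partial labelling. One observes pairs $(X,S)\sim\nu$, where $X\in\mathcal X$ is an input and $S\subset\mathcal Y$ is a set of candidate labels. A distribution $\mu$ on $\mathcal X\times\mathcal Y$ is compatible with $\nu$, written $\mu\vdash\nu$, if there is a distribution $\pi$ on $\mathcal X\times\mathcal Y\times2^{\mathcal Y}$ with marginals $\mu$ on $\mathcal X\times\mathcal Y$ and $\nu$ on $\mathcal X\times2^{\mathcal Y}$, and such that $y\in s$ for every $(x,y,s)$ in the support of $\pi$. Define $$\mu^*\in\operatorname*{arg\,min}_{\mu\vdash\nu}\ \inf_{f:\mathcal X\to\mathcal Y}\mathbb E_{(X,Y)\sim\mu}[\ell(f(X),Y)],\qquad f^*\in\operatorname*{arg\,min}_{f:\mathcal X\to\mathcal Y}\mathbb E_{(X,Y)\sim\mu^*}[\ell(f(X),Y)],$$ and the risk $\mathcal R(f)=\mathbb E_{(X,Y)\sim\mu^*}[\ell(f(X),Y)]$. Both minimizations decouple over inputs and are understood pointwise in $x\in\operatorname{supp}\nu_{\mathcal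 X}$. Surrogate. $\mathcal H$ is a separable Hilbert space and $\phi,\psi:\mathcal Y\to\mathcal H$ are fixed maps with $\ell(z,y)=\langle\psi(z),\phi(y)\rangle$ for all $z,y\in\mathcal Y$. Put $c_\psi=\sup_{z\in\mathcal Y}\|\psi(z)\|$, $c_\phi=\sup_{y\in\mathcal Y}\|\phi(y)\|$, and $g^*(x)=\mathbb E_{\mu^*}[\phi(Y)\mid X=x]$. Nearest-neighbor weights. For an integer parameter $k\ge1$ (the number of neighbors), data $x_1,\dots,x_n$ and $x\in\mathcal X$, $\alpha_i(x)=1/k$ if $\#\{j\le n: d(x,x_j)\le d(x,x_i)\}\le k$, and $\alpha_i(x)=0$ otherwise. It is assumed that ties in defining nearest neighbors do not happen. Estimator. From data $(x_i,s_i)_{i\le n}$, first compute $$(\hat y_i)_{i\le n}\in\operatorname*{arg\,min}_{(y_i)\in\prod_{i\le n}s_i}\ \inf_{(z_i)\in\mathcal Y^n}\ \sum_{i,j=1}^n\alpha_j(x_i)\,\ell(z_i,y_j),$$ then define $f_n(x)\in\operatorname*{arg\,min}_{z\in\mathcal Y}\sum_{i=1}^n\alpha_i(x)\,\ell(z,\hat y_i)$. The expectation $\mathbb E_{\mathcal D_n}$ is over the sample $\mathcal D_n$.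
   Formalization: The final rate is stated as O(n exp(-cn)) for some c>0 depending on p, k_0 and eta, with k_n the integer part of k_0 n and k_0>0: the literal O(n exp(-n)) is false, e.g. for eta>1/e, when all candidate sets are ambiguous with probability eta^n. *)

(* Defs.v *)
From HB Require Import structures.
From mathcomp Require Import all_boot all_order all_algebra.
From mathcomp Require Import sesquilinear.
From mathcomp Require Import all_classical all_reals all_analysis.
Set Implicit Arguments.
Unset Strict Implicit.
Unset Printing Implicit Defensive.
Import Order.TTheory GRing.Theory Num.Theory.
Import numFieldNormedType.Exports.
Local Open Scope classical_set_scope.
Local Open Scope ring_scope.

(* Measurable types are pointed in this library; a space or label set carrying
   a probability measure is nonempty, so a base point is no restriction. *)
#[short(type="pmetricType")]
HB.structure Definition PointedMetric (K : numDomainType) :=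
  {T of Metric K T & Pointed T}.

#[short(type="pfinType")]
HB.structure Definition PointedFinite := {T of Finite T & Pointed T}.

HB.instance Definition _ (T : finType) := isPointed.Build {set T} finset.set0.

Definition borel (T : ptopologicalType) := g_sigma_algebraType (@open T).
HB.instance Definition _ (T : ptopologicalType) := Measurable.on (borel T).

Definition discrete (T : Type) : Type := T.
HB.instance Definition _ (T : pointedType) := Pointed.on (discrete T).
HB.instance Definition _ (T : pointedType) :=
  @isMeasurable.Build default_measure_display (discrete T)
    discrete_measurable discrete_measurable0
    discrete_measurableC discrete_measurableU.

Definition argmin {d : Order.disp_t} {T : Type} {U : porderType d}
    (A : set T) (F : T -> U) : set T :=
  [set a | A a /\ forall b, A b -> (F a <= F b)%O].

Section probability_laws.
Context {d1 d2 : measure_display} {T1 : measurableType d1}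
  {T2 : measurableType d2} {R : realType}.

HB.instance Definition _ :=
  isMeasurableFun.Build _ _ _ _ (@fst T1 T2) measurable_fst.

Definition fst_marginal (rho : probability (T1 * T2)%type R) : probability T1 R :=
  distribution rho (@fst T1 T2).

(* kappa is a version of the conditional law of the second component given the
   first one. *)
Definition conditional_law (rho : probability (T1 * T2)%type R)
    (kappa : R.-pker T1 ~> T2) : Prop :=
  forall A B, measurable A -> measurable B ->
    (rho (A `*` B) = \int[fst_marginal rho]_(x in A) kappa x B)%E.

End probability_laws.

Section iid.
Context {d : measure_display} {T : measurableType d} {R : realType}.

Definition cons_pair n (w : T * n.-tuple T) : n.+1.-tuple T :=
  [tuple of w.1 :: w.2].

Lemma measurable_cons_pair n : measurable_fun setT (@cons_pair n).
Proof. exact: measurable_cons measurable_fst measurable_snd. Qed.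

HB.instance Definition _ n :=
  isMeasurableFun.Build _ _ _ _ (@cons_pair n) (@measurable_cons_pair n).

Fixpoint iid_law (P : probability T R) (n : nat) : probability (n.-tuple T) R :=
  match n return probability (n.-tuple T) R with
  | 0%N => \d_([tuple] : 0.-tuple T)
  | n'.+1 => distribution (P \x iid_law P n')%E (@cons_pair n')
  end.

End iid.

Definition msupport {R : realType} {T : ptopologicalType}
    (m : set (borel T) -> \bar R) : set T :=
  [set x | forall U : set T, open U -> U x -> (0 < m U)%E].

Section partial_labelling.
Context {R : realType} {X : pmetricType R} {Y : pfinType}.

Local Notation input := (borel X).
Local Notation label := (discrete Y).
Local Notation labels := (discrete {set Y}).

(* Y and 2^Y carry the discrete topology, so that the sets U x {y} x {s} with U
   an open neighborhood of x form a neighborhood basis of (x, y, s). *)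
Definition in_joint_support (pi : set (input * label * labels) -> \bar R)
    (x : X) (y : Y) (s : {set Y}) : Prop :=
  forall U : set X, open U -> U x ->
    (0 < pi [set w | [/\ U w.1.1, w.1.2 = y & w.2 = s]])%E.

Definition compatible (mu : probability (input * label)%type R)
    (nu : probability (input * labels)%type R) : Prop :=
  exists pi : probability (input * label * labels)%type R,
  [/\ forall A, measurable A -> pi [set w | A w.1] = mu A,
      forall B, measurable B -> pi [set w | B (w.1.1, w.2)] = nu B &
      forall x y s, in_joint_support pi x y s -> y \in s].

(* The same relation between the conditional laws at a given input. *)
Definition compatible_at (p : {measure set label -> \bar R})
    (q : {measure set labels -> \bar R}) : Prop :=
  exists pi : probability (label * labels)%type R,
  [/\ forall A, pi [set w | A w.1] = p A,
      forall B, pi [set w | B w.2] = q B &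
      forall y s, (0 < pi [set (y, s)])%E -> y \in s].

Variable ell : Y -> Y -> R.

Definition pointwise_risk (p : {measure set label -> \bar R}) (z : Y) : \bar R :=
  (\int[p]_y (ell z y)%:E)%E.

Definition risk (mu : probability (input * label)%type R) (f : X -> Y) : \bar R :=
  (\int[mu]_w (ell (f w.1) w.2)%:E)%E.

(* mu is a minimizer of inf_f E_mu[ell(f(X), Y)] over the distributions
   compatible with nu, in the pointwise sense: knu and kmu are versions of the
   conditional laws given the input. *)
Definition optimal_disambiguation (nu : probability (input * labels)%type R)
    (knu : R.-pker input ~> labels)
    (mu : probability (input * label)%type R)
    (kmu : R.-pker input ~> label) : Prop :=
  [/\ compatible mu nu, conditional_law mu kmu &
      forall x, msupport (fst_marginal nu) x ->
        argmin [set p | compatible_at p (knu x)]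
               (fun p => ereal_inf (range (pointwise_risk p))) (kmu x)].

Definition optimal_predictor (nuX : probability input R)
    (kmu : R.-pker input ~> label) (f : X -> Y) : Prop :=
  forall x, msupport nuX x -> argmin setT (pointwise_risk (kmu x)) (f x).

Definition conditional_mean {H : lmodType R} (kmu : R.-pker input ~> label)
    (phi : Y -> H) (x : X) : H :=
  \sum_(y : Y) fine (kmu x [set y]) *: phi y.

Section estimator.
Variables (n k : nat) (xs : 'I_n -> X) (ss : 'I_n -> {set Y}).

Definition knn_weight (x : X) (i : 'I_n) : R :=
  if (#|[pred j : 'I_n | (mdist x (xs j) <= mdist x (xs i))%R]| <= k)%N
  then k%:R^-1 else 0.

Definition disambiguation_objective (ys : 'I_n -> Y) : R :=
  inf (range (fun zs : 'I_n -> Y =>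
    \sum_(i < n) \sum_(j < n) knn_weight (xs i) j * ell (zs i) (ys j))).

Definition disambiguation : set ('I_n -> Y) :=
  argmin [set ys | forall i, ys i \in ss i] disambiguation_objective.

Definition knn_estimator (f : X -> Y) : Prop :=
  exists2 ys, disambiguation ys &
    forall x, argmin setT
      (fun z => \sum_(i < n) knn_weight x i * ell z (ys i)) (f x).

End estimator.

Definition inputs n (D : n.-tuple (input * labels)) (i : 'I_n) : X :=
  (tnth D i).1.

Definition candidates n (D : n.-tuple (input * labels)) (i : 'I_n) : {set Y} :=
  (tnth D i).2.

(* Ties may occur on a null set of samples and, for a given sample, on a null
   set of inputs. *)
Definition no_ties (nu : probability (input * labels)%type R) (n : nat) : Prop :=
  {ae iid_law nu n, forall D,
    (forall i, injective (fun j => mdist (inputs D i) (inputs D j))) /\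
    {ae fst_marginal nu, forall x, injective (fun j => mdist x (inputs D j))}}.

(* Almost sure, since on a null set of samples a candidate set may be empty, and
   then no disambiguation exists.  No measurability is asked of the selection
   fhat among the minimizers. *)
Definition knn_rule (nu : probability (input * labels)%type R) (n k : nat)
    (fhat : n.-tuple (input * labels) -> X -> Y) : Prop :=
  {ae iid_law nu n, forall D,
    knn_estimator k (inputs D) (candidates D) (fhat D)}.

Definition excess_risk (nu : probability (input * labels)%type R)
    (mu : probability (input * label)%type R) (fstar : X -> Y) (n : nat)
    (fhat : n.-tuple (input * labels) -> X -> Y) : \bar R :=
  (\int[iid_law nu n]_D risk mu (fhat D) - risk mu fstar)%E.

End partial_labelling.

(* Main.v *)
Require Import Defs.
From HB Require Import structures.
From mathcomp Require Import all_boot all_order all_algebra.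
From mathcomp Require Import sesquilinear.
From mathcomp Require Import all_classical all_reals all_analysis.
From mathcomp Require Import measurable_realfun measurable_fun_approximation.
From mathcomp Require Import lra.
Set Implicit Arguments.
Unset Strict Implicit.
Unset Printing Implicit Defensive.
Import Order.TTheory GRing.Theory Num.Theory.
Import numFieldNormedType.Exports.
Local Open Scope classical_set_scope.
Local Open Scope ring_scope.

(* On the support of nu_X the minimal conditional risk is 0, reached by the Dirac
   mass at the non-ambiguous label, so mu* is supported by the graph of f*, phi
   is injective, and the Lipschitz condition on g* separates the level sets of
   f*.  If every sample point and the test point x have k sample points within
   distance h, the correct labels have disambiguation objective 0; an optimal
   disambiguation is then constant on each neighborhood of a sample point, and
   its value there is a label common to all the candidate sets of the
   neighborhood.  A wrong value thus forces k independent events of conditional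
   probability at most eta, while a Laplace transform bounds the probability that
   some ball is too sparse.  The excess risk at x is at most 2 c_psi c_phi times
   the fraction of wrong labels among the neighbors of x, which is why no factor
   k appears in front of m eta^k.

   No measurability of the selection fhat is available, and the integral of a
   non-measurable nonnegative function is a lower integral, which is monotone but
   not additive; so the risk is dominated by one explicit measurable function of
   the sample and the test point before anything is integrated. *)

(** * Nearest neighbors and disambiguation of a fixed sample *)

Section ranks.
Context {R : realDomainType} {n : nat}.
Implicit Types (d : 'I_n -> R) (k : nat).

Definition rank d (i : 'I_n) : nat := #|[pred j : 'I_n | d j <= d i]|.

Definition nearest k d : {set 'I_n} := [set i | (rank d i <= k)%N].

Lemma rank_gt0 d i : (0 < rank d i)%N.
Proof. by apply/card_gt0P; exists i; rewrite inE. Qed.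

(** The farthest member has every other member within its distance, so its rank, at most [k], bounds
    the size of the set. This argument tolerates ties. *)
Lemma card_nearest_le k d : (#|nearest k d| <= k)%N.
Proof.
have [/eqP ->|/set0Pn[i0 i0N]] := boolP (nearest k d == finset.set0).
  by rewrite cards0.
have [i iN imax] := @arg_maxP _ _ _ i0 (fun i => i \in nearest k d) d i0N.
move: (iN); rewrite inE; apply: leq_trans.
by apply/subset_leq_card/fintype.subsetP => j jN; rewrite inE; exact: imax.
Qed.

Lemma card_nearest k d : injective d -> (k <= n)%N -> #|nearest k d| = k.
Proof.
move=> dI kn.
have rank_lt i : ((rank d i).-1 < n)%N.
  by rewrite prednK ?rank_gt0// (leq_trans (max_card _))// card_ord.
(* Ranks start at 1; shifted by one, they give a self-map of ['I_n]. Without ties it is injective,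
   hence onto, and the nearest points are the preimage of the first [k] indices. *)
pose g i := Ordinal (rank_lt i).
have rank_mono i j : d i < d j -> (rank d i < rank d j)%N.
  move=> dij; apply/proper_card/properP; split.
    by apply/fintype.subsetP => l; rewrite !inE => /le_trans -> //; exact: ltW.
  by exists j; rewrite !inE// -ltNge.
have gI : injective g.
  move=> i j /(congr1 val)/= ij; apply: dI; apply/eqP.
  have {ij}ij : rank d i = rank d j by rewrite -[LHS]prednK ?rank_gt0// ij prednK ?rank_gt0.
  by case: ltgtP => // /rank_mono; rewrite ij ltnn.
have wI : injective (widen_ord kn) by move=> a b /(congr1 val)/= /val_inj.
rewrite -[RHS](card_ord k) -(fintype.card_image wI) -(card_imset _ gI).
apply: eq_card => j; apply/imsetP/fintype.imageP => [[i iN ->]|[l _ ->]].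
  move: iN; rewrite inE => ik.
  have lik : ((rank d i).-1 < k)%N by rewrite prednK ?rank_gt0.
  by exists (Ordinal lik) => //; apply: val_inj.
have [g' _ g'K] := injF_bij gI.
exists (g' (widen_ord kn l)); last by rewrite g'K.
rewrite inE -[rank _ _]prednK ?rank_gt0//.
by have /(congr1 val)/= -> := g'K (widen_ord kn l); exact: ltn_ord.
Qed.

(** A point at distance at least [h] counts in its rank all the points closer than [h] and also
    itself, which exceeds [k]. *)
Lemma nearest_lt k d (h : R) i :
  (k <= #|[pred j | (d j < h)%R]|)%N -> i \in nearest k d -> d i < h.
Proof.
rewrite inE => kh; rewrite ltNge; apply: contraTN => hi.
rewrite -ltnNge (leq_ltn_trans kh)//; apply/proper_card/properP; split.
  by apply/fintype.subsetP => j; rewrite !inE => /ltW/le_trans; exact.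
by exists i; rewrite !inE ?lexx// -leNgt.
Qed.

End ranks.

Lemma knn_weightE (R : realType) (X : pmetricType R) n k (xs : 'I_n -> X) x i :
  knn_weight k xs x i =
  if i \in nearest k (fun j => mdist x (xs j)) then k%:R^-1 else 0.
Proof. by rewrite /knn_weight inE. Qed.

Lemma knn_weight_ge0 (R : realType) (X : pmetricType R) n k (xs : 'I_n -> X) x i :
  0 <= knn_weight k xs x i.
Proof. by rewrite knn_weightE; case: ifP. Qed.

Lemma sum_knn_weight (R : realType) (X : pmetricType R) n k (xs : 'I_n -> X) x :
  \sum_(i < n) knn_weight k xs x i =
  #|nearest k (fun j => mdist x (xs j))|%:R / k%:R.
Proof.
under eq_bigr do rewrite knn_weightE.
by rewrite -big_mkcond/= sumr_const mulr_natl.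
Qed.

Lemma sum_knn_weight_le1 (R : realType) (X : pmetricType R) n k
  (xs : 'I_n -> X) x : \sum_(i < n) knn_weight k xs x i <= 1.
Proof.
rewrite sum_knn_weight; have [->|k0] := posnP k; first by rewrite invr0 mulr0 ler01.
by rewrite ler_pdivrMr ?ltr0n// mul1r ler_nat card_nearest_le.
Qed.

Section deterministic.
Context {R : realType} {X : pmetricType R} {Y : pfinType}.
Variables (ell : Y -> Y -> R) (C : R).
Hypothesis ell_diag : forall y, ell y y = 0.
Hypothesis ell_proper : forall z y, z != y -> 0 < ell z y.
Hypothesis ell_le : forall z y, ell z y <= C.

Lemma ell_ge0 z y : 0 <= ell z y.
Proof. by have [->|/ell_proper/ltW//] := eqVneq z y; rewrite ell_diag. Qed.

Variables (f : X -> Y) (A : set X) (h : R).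
Hypothesis f_locconst :
  forall x x', A x -> A x' -> mdist x x' < h -> f x = f x'.

Variables (n k : nat) (xs : 'I_n -> X) (ss : 'I_n -> {set Y}).
Hypothesis k_gt0 : (0 < k)%N.
Hypothesis xsA : forall i, A (xs i).
Hypothesis f_ss : forall i, f (xs i) \in ss i.
Hypothesis xs_inj : forall i, injective (fun j => mdist (xs i) (xs j)).
Hypothesis xs_dense :
  forall i, (k <= #|[pred j | (mdist (xs i) (xs j) < h)%R]|)%N.

Local Notation N x := (nearest k (fun j => mdist x (xs j))).

Lemma nearest_self i : i \in N (xs i).
Proof.
rewrite inE (leq_trans _ k_gt0)// -(card1 i).
apply/subset_leq_card/fintype.subsetP => j; rewrite !inE mdistxx => ji.
apply/eqP/(@xs_inj i j i) => /=; rewrite mdistxx; apply/eqP.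
by rewrite eq_le ji mdist_ge0.
Qed.

(** The objective decouples over [i] and there are finitely many labels, so minimizing each summand
    separately attains the infimum. *)
Lemma disambiguation_objective_attained (ys : 'I_n -> Y) :
  disambiguation_objective ell k xs ys <= 0 ->
  exists zs : 'I_n -> Y,
    \sum_(i < n) \sum_(j < n) knn_weight k xs (xs i) j * ell (zs i) (ys j) <= 0.
Proof.
move=> obj.
pose F i z := \sum_(j < n) knn_weight k xs (xs i) j * ell z (ys j).
pose zs i := [arg min_(z < point) F i z]%O.
exists zs; apply: le_trans obj; apply: lb_le_inf => [|_ [zs' _ <-]].
  by exists (\sum_(i < n) F i (zs i)); exists zs.
apply: ler_sum => i _; rewrite -/(F i (zs i)) -/(F i (zs' i)) /zs.
by case: arg_minP => // z _; exact.
Qed.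

(* All labels of a neighborhood agree, so a wrong label must be a candidate
   throughout the neighborhood. *)
Lemma disambiguation_error (ys : 'I_n -> Y) i :
  disambiguation ell k xs ss ys ->
  forall j, j \in N (xs i) ->
    ys i \in ss j /\ f (xs j) = f (xs i).
Proof.
move=> [ys_ss ys_min] j jN.
have fN a b : b \in N (xs a) -> f (xs b) = f (xs a).
  by move=> /(nearest_lt (xs_dense a)) ab; apply/esym/f_locconst.
(* The true labels are feasible, and they cost nothing because they are constant on each
   neighborhood. *)
have obj : disambiguation_objective ell k xs ys <= 0.
  apply: le_trans (ys_min (f \o xs) f_ss) _; apply: ge_inf.
    exists 0 => _ [zs _ <-]; apply: sumr_ge0 => a _; apply: sumr_ge0 => b _.
    by rewrite mulr_ge0 ?knn_weight_ge0 ?ell_ge0.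
  exists (f \o xs) => //; apply: big1 => a _; apply: big1 => b _.
  rewrite knn_weightE; case: ifPn => [/fN /= ->|_]; last by rewrite mul0r.
  by rewrite ell_diag mulr0.
have [zs zs0] := disambiguation_objective_attained obj.
have zs_eq a b : b \in N (xs a) -> ys b = zs a.
  move=> bN; apply/eqP; rewrite eq_sym; apply: contraT => /ell_proper zy.
  suff : 0 < \sum_(a < n) \sum_(b < n) knn_weight k xs (xs a) b * ell (zs a) (ys b).
    by rewrite ltNge zs0.
  have T0 a' b' : 0 <= knn_weight k xs (xs a') b' * ell (zs a') (ys b').
    by rewrite mulr_ge0 ?knn_weight_ge0 ?ell_ge0.
  rewrite (bigD1 a)//= (bigD1 b)//= -addrA ltr_pwDl//.
    by rewrite knn_weightE bN mulr_gt0// invr_gt0 ltr0n.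
  by rewrite addr_ge0//; apply: sumr_ge0 => // a' _; apply: sumr_ge0.
split; last exact: fN.
(* Since [i] belongs to its own neighborhood, [ys i = zs i = ys j], and [ys j] is a candidate at
   [j]. *)
by rewrite (zs_eq i i (nearest_self i)) -(zs_eq i j jN).
Qed.

(** The wrong label [z] is quantified instead of being read off a disambiguation, so that the event
    depends on the sample alone, however the minimizer is selected. *)
Definition misled (i : 'I_n) : bool :=
  [exists z, [forall j in N (xs i), (z \in ss j) && (f (xs j) != z)]].

Lemma knn_estimator_error (g : X -> Y) x :
  A x -> injective (fun j => mdist x (xs j)) ->
  (k <= #|[pred j | (mdist x (xs j) < h)%R]|)%N ->
  knn_estimator ell k xs ss g ->
  ell (g x) (f x) <=
    2 * C * \sum_(i < n) knn_weight k xs x i * (misled i)%:R.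
Proof.
move=> Ax x_inj x_dense [ys ys_dis g_min].
have kn : (k <= n)%N by rewrite (leq_trans x_dense)// (leq_trans (max_card _))// card_ord.
have sum1 : \sum_(i < n) knn_weight k xs x i = 1.
  by rewrite sum_knn_weight card_nearest// divff// pnatr_eq0 -lt0n.
have -> : ell (g x) (f x) = \sum_(i < n) knn_weight k xs x i * ell (g x) (f x).
  by rewrite -mulr_suml sum1 mul1r.
(* Optimality of [g x] against [f x] gives a nonnegative gap [gf]. Once it is added, the terms with
   [ys i = f x] cancel and every other term is at most [2 * C] times its weight. *)
have /= [_ /(_ (f x) I)] := g_min x; rewrite -subr_ge0 => gf.
rewrite mulr_sumr -[leLHS]addr0; apply: le_trans (lerD (lexx _) gf) _.
rewrite -sumrB -big_split/=; apply: ler_sum => i _.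
have [w0|] := eqVneq (knn_weight k xs x i) 0; first by rewrite w0 !mul0r mulr0 !add0r oppr0.
rewrite -mulrBr -mulrDr mulrCA => w_neq0; rewrite ler_wpM2l ?knn_weight_ge0//.
have iN : i \in N x.
  by move: w_neq0; rewrite knn_weightE; case: ifP; rewrite ?eqxx.
have fxi : f (xs i) = f x.
  by apply/esym/f_locconst => //; exact: (nearest_lt x_dense).
have [yf|yf] := eqVneq (ys i) (f x).
  rewrite yf ell_diag sub0r subrr mulr_ge0//.
  by rewrite mulr_ge0// (le_trans (ell_ge0 point point)).
have -> : misled i.
  apply/existsP; exists (ys i); apply/forall_inP => j jN.
  have [-> fj] := disambiguation_error ys_dis jN.
  by rewrite fj fxi eq_sym.
rewrite mulr1 mulr_natl mulr2n lerD// lerBlDr.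
by rewrite (le_trans (ell_le _ _))// lerDl ell_ge0.
Qed.
End deterministic.

(** * Integrals of possibly non-measurable nonnegative functions *)

Section lower_integral.
Context {d : measure_display} {T : measurableType d} {R : realType}.
Variable mu : {measure set T -> \bar R}.
Local Open Scope ereal_scope.

(* The integral of a nonnegative function is a supremum over the simple
   functions below it, hence monotone without any measurability. *)
Lemma le_integral_nonmeasurable (f g : T -> \bar R) :
  (forall x, 0 <= f x) -> (forall x, f x <= g x) ->
  \int[mu]_x f x <= \int[mu]_x g x.
Proof.
move=> f0 fg.
have g0 x : 0 <= g x by exact: le_trans (fg x).
rewrite !ge0_integralTE//; apply: ge_ereal_sup => _ [k kf <-].
by apply: ereal_sup_ubound; exists k => // x; exact: le_trans (fg x).
Qed.

(** The exceptional null set is absorbed on the measurable side: raising [g] to [+oo] there keeps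
    its integral and makes the inequality hold everywhere. *)
Lemma ae_le_integral_nonmeasurable (f g : T -> \bar R) :
  (forall x, 0 <= f x) -> (forall x, 0 <= g x) ->
  measurable_fun [set: T] g -> {ae mu, forall x, f x <= g x} ->
  \int[mu]_x f x <= \int[mu]_x g x.
Proof.
move=> f0 g0 mg [N [mN N0 fgN]].
pose g' x := if x \in N then +oo else g x.
have mg' : measurable_fun [set: T] g'.
  apply: measurable_fun_ifT => //; apply: (measurable_fun_bool true).
  rewrite setTI (_ : _ @^-1` _ = N)//.
  by apply/seteqP; split => [x /set_mem|x /mem_set].
have -> : \int[mu]_x g x = \int[mu]_x g' x.
  apply: ge0_ae_eq_integral => //; first by move=> x _; rewrite /g'; case: ifP.
  exists N; split => // x /=; rewrite /g' => /not_implyP[_].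
  by case: ifPn => [|_]; [rewrite inE|].
apply: le_integral_nonmeasurable => // x; rewrite /g'; case: ifPn => [_|/negP xN].
  exact: leey.
by apply: contrapT => fg; apply: xN; rewrite inE; exact: fgN.
Qed.

End lower_integral.

(** The inner bound is asked only where the weight [a] is nonzero; an indicator hidden in [a] can
    thus confine it to the points where it is known. *)
Lemma weighted_integral_le {d1 d2 : measure_display} {T1 : measurableType d1}
    {T2 : measurableType d2} {R : realType} (m1 : {measure set T1 -> \bar R})
    (m2 : {measure set T2 -> \bar R}) (a : T1 -> R) (v : T1 -> T2 -> R) (b : R) :
  measurable_fun setT a -> (forall w, measurable_fun setT (v w)) ->
  (forall w, 0 <= a w) -> (forall w x, 0 <= v w x) -> 0 <= b ->
  (forall w, a w != 0 -> (\int[m2]_x (v w x)%:E <= b%:E)%E) ->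
  (\int[m1]_w \int[m2]_x (a w * v w x)%:E <= b%:E * \int[m1]_w (a w)%:E)%E.
Proof.
move=> ma mv a0 v0 b0 vb.
rewrite -ge0_integralZl//; last 2 first.
- exact/measurable_EFinP.
- by move=> w _; rewrite lee_fin.
apply: le_integral_nonmeasurable => w.
  by apply: integral_ge0 => x _; rewrite lee_fin mulr_ge0.
under eq_integral do rewrite EFinM.
rewrite ge0_integralZl//; first last.
- by rewrite lee_fin.
- by move=> x _; rewrite lee_fin.
- exact/measurable_EFinP.
have [->|aw] := eqVneq (a w) 0; first by rewrite mul0e mule0.
by rewrite muleC lee_wpmul2r ?lee_fin//; exact: vb.
Qed.

(** * Integration against the law of an i.i.d. sample *)

Section iid_integrals.
Context {d : measure_display} {T : measurableType d} {R : realType}.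
Variable P : probability T R.
Local Open Scope ereal_scope.

Lemma iid_law_integral_cons n (F : n.+1.-tuple T -> \bar R) :
  measurable_fun setT F -> (forall D, 0 <= F D) ->
  \int[iid_law P n.+1]_D F D =
  \int[P]_w \int[iid_law P n]_D F (cons_pair (w, D)).
Proof.
move=> mF F0; rewrite /= ge0_integral_distribution//.
rewrite fubini_tonelli1; [by []| |by move=> x; exact: F0].
exact: measurableT_comp mF (@measurable_cons_pair _ _ _).
Qed.

Lemma iid_law_integral0 (F : 0.-tuple T -> \bar R) :
  measurable_fun setT F -> \int[iid_law P 0]_D F D = F [tuple].
Proof. by move=> mF; rewrite /= integral_dirac// diracT mul1e. Qed.

Lemma measurable_cons_pairl n (w : T) :
  measurable_fun setT (fun D : n.-tuple T => cons_pair (w, D)).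
Proof. by apply: measurableT_comp => //; exact: measurable_pair1. Qed.

Lemma tnth_cons_pair0 n (w : T) (D : n.-tuple T) :
  tnth (cons_pair (w, D)) ord0 = w.
Proof. by []. Qed.

Lemma tnth_cons_pair_lift n (w : T) (D : n.-tuple T) i :
  tnth (cons_pair (w, D)) (lift ord0 i) = tnth D i.
Proof. by rewrite tnthS. Qed.

Lemma measurable_prod_tnth n (v : 'I_n -> T -> R) :
  (forall i, measurable_fun setT (v i)) ->
  measurable_fun setT (fun D : n.-tuple T => (\prod_(i < n) v i (tnth D i))%:E).
Proof.
move=> mv; apply/measurable_EFinP; apply: measurable_prod => i _.
by apply: measurableT_comp => //; exact: measurable_tnth.
Qed.

Lemma iid_law_prod_le (v : T -> R) (c : R) n :
  measurable_fun setT v -> (forall w, (0 <= v w)%R) -> (0 <= c)%R ->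
  \int[P]_w (v w)%:E <= c%:E ->
  \int[iid_law P n]_D (\prod_(i < n) v (tnth D i))%:E <= (c ^+ n)%:E.
Proof.
move=> mv v0 c0 vc; elim: n => [|n IH].
  by rewrite iid_law_integral0 ?big_ord0 ?expr0//; exact: (measurable_prod_tnth (fun=> mv)).
rewrite iid_law_integral_cons; first last.
- by move=> D; rewrite lee_fin prodr_ge0.
- exact: (measurable_prod_tnth (fun=> mv)).
have -> : \int[P]_w \int[iid_law P n]_D
    (\prod_(i < n.+1) v (tnth (cons_pair (w, D)) i))%:E =
    \int[P]_w ((v w)%:E * \int[iid_law P n]_D (\prod_(i < n) v (tnth D i))%:E).
  apply: eq_integral => w _; rewrite -ge0_integralZl//.
  - apply: eq_integral => D _; rewrite big_ord_recl tnth_cons_pair0 EFinM.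
    by under eq_bigr do rewrite tnth_cons_pair_lift.
  - exact: (measurable_prod_tnth (fun=> mv)).
  - by move=> D _; rewrite lee_fin prodr_ge0.
  - by rewrite lee_fin.
have I0 : 0 <= \int[iid_law P n]_D (\prod_(i < n) v (tnth D i))%:E.
  by apply: integral_ge0 => D _; rewrite lee_fin prodr_ge0.
rewrite ge0_integralZr//; last 2 first.
- exact/measurable_EFinP.
- by move=> w _; rewrite lee_fin.
by rewrite exprS EFinM lee_pmul// integral_ge0// => w _; rewrite lee_fin.
Qed.

Lemma measurable_prod_pair_tnth n (i : 'I_n) (a : T -> R) (u : T -> T -> R) :
  measurable_fun setT a -> measurable_fun setT (fun w => u w.1 w.2) ->
  measurable_fun setT (fun D : n.-tuple T => (\prod_(j < n)
    (if j == i then a (tnth D i) else u (tnth D i) (tnth D j)))%:E).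
Proof.
move=> ma mu; apply/measurable_EFinP; apply: measurable_prod => j _.
have mt l : measurable_fun setT (fun D : n.-tuple T => tnth D l).
  exact: measurable_tnth.
case: (j == i); first exact: measurableT_comp ma (mt i).
exact: measurableT_comp mu (measurable_fun_pair (mt i) (mt j)).
Qed.

(** When the new point is not the marked one, its factor is absorbed into the weight of the marked
    point, which restores the shape of the product for an induction. *)
Lemma prod_pair_cons_lift n (i : 'I_n) (a : T -> R) (u : T -> T -> R) w
    (D : n.-tuple T) :
  (\prod_(j < n.+1) (if j == lift ord0 i
     then a (tnth (cons_pair (w, D)) (lift ord0 i))
     else u (tnth (cons_pair (w, D)) (lift ord0 i)) (tnth (cons_pair (w, D)) j))
   = \prod_(j < n) (if j == i then a (tnth D i) * u (tnth D i) w
                    else u (tnth D i) (tnth D j)))%R.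
Proof.
rewrite big_ord_recl (negPf (neq_lift _ _)) tnth_cons_pair_lift tnth_cons_pair0.
under eq_bigr do rewrite (inj_eq (@lift_inj _ ord0)) tnth_cons_pair_lift.
rewrite (bigD1 i)//= eqxx [in RHS](bigD1 i)//= eqxx mulrA [(u _ w * _)%R]mulrC.
by congr (_ * _)%R; apply: eq_bigr => j /negPf ->.
Qed.

Lemma prod_pair_cons0 n (a : T -> R) (u : T -> T -> R) w (D : n.-tuple T) :
  (\prod_(j < n.+1) (if j == ord0 then a (tnth (cons_pair (w, D)) ord0)
     else u (tnth (cons_pair (w, D)) ord0) (tnth (cons_pair (w, D)) j))
   = a w * \prod_(j < n) u w (tnth D j))%R.
Proof.
rewrite big_ord_recl eqxx tnth_cons_pair0; congr (_ * _)%R.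
by apply: eq_bigr => j _; rewrite tnth_cons_pair_lift.
Qed.

(** Given the marked point, the other [n.-1] factors are independent with mean at most [c]. The
    induction generalizes over [a], since unmarked points are peeled off into it. *)
Lemma iid_law_prod_pair_le (u : T -> T -> R) (c : R) n (i : 'I_n) (a : T -> R) :
  measurable_fun setT (fun w => u w.1 w.2) -> (forall w w', (0 <= u w w')%R) ->
  (0 <= c)%R -> measurable_fun setT a -> (forall w, (0 <= a w)%R) ->
  (forall w, a w != 0%R -> \int[P]_w' (u w w')%:E <= c%:E) ->
  \int[iid_law P n]_D (\prod_(j < n)
     (if j == i then a (tnth D i) else u (tnth D i) (tnth D j)))%:E
  <= (c ^+ n.-1)%:E * \int[P]_w (a w)%:E.
Proof.
move=> mu u0 c0; elim: n i a => [[]//|n IH] i a ma a0 uc.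
have ul w : measurable_fun setT (u w).
  exact: measurableT_comp mu (measurable_pair1 w).
have ur w : measurable_fun setT (u ^~ w).
  exact: measurableT_comp mu (measurable_pair2 w).
rewrite iid_law_integral_cons; first last.
- by move=> D; rewrite lee_fin prodr_ge0// => j _; case: ifP.
- exact: measurable_prod_pair_tnth.
case: (unliftP ord0 i) => [i'|] ->.
- apply: (@le_trans _ _ (\int[P]_w ((c ^+ n.-1)%:E *
      \int[P]_x (a x * u x w)%:E))).
    apply: le_integral_nonmeasurable => w.
      apply: integral_ge0 => D _.
      by rewrite lee_fin prodr_ge0// => j _; case: ifP.
    under eq_integral do rewrite prod_pair_cons_lift.
    apply: IH => [|x|x].
    + exact: measurable_funM.
    + exact: mulr_ge0.
    + by rewrite mulf_eq0 negb_or => /andP[/uc].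
  rewrite ge0_integralZl//; first last.
  + by rewrite lee_fin exprn_ge0.
  + by move=> w _; apply: integral_ge0 => x _; rewrite lee_fin mulr_ge0.
  + apply: (measurable_fun_fubini_tonelli_F
        (fun z => (a z.2 * u z.2 z.1)%:E)) => [|z]; last first.
      by rewrite lee_fin mulr_ge0.
    apply/measurable_EFinP; apply: measurable_funM; first exact: measurableT_comp.
    exact: (measurableT_comp mu (measurable_fun_pair measurable_snd measurable_fst)).
  have -> : (c ^+ n.+1.-1 = c ^+ n.-1 * c)%R.
    by rewrite -exprSr prednK// (leq_ltn_trans _ (ltn_ord i')).
  rewrite EFinM -muleA lee_wpmul2l ?lee_fin ?exprn_ge0//.
  (* The order is exchanged so that the peeled point is integrated first, with the marked point
     fixed; this yields the missing factor [c]. *)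
  rewrite (fubini_tonelli (fun z => (a z.2 * u z.2 z.1)%:E))/=; first last.
  + by move=> z; rewrite lee_fin mulr_ge0.
  + by apply/measurable_EFinP; apply: measurable_funM; [exact: measurableT_comp|];
      exact: (measurableT_comp mu (measurable_fun_pair measurable_snd measurable_fst)).
  exact: weighted_integral_le.
- under eq_integral do under eq_integral do rewrite prod_pair_cons0.
  apply: (@weighted_integral_le _ _ _ _ _ _ _ a (fun w (D : n.-tuple T) =>
    (\prod_(j < n) u w (tnth D j))%R)) => //.
  + move=> w; apply/measurable_EFinP; exact: (measurable_prod_tnth (fun=> ul w)).
  + by move=> w D; rewrite prodr_ge0.
  + by rewrite exprn_ge0.
  + by move=> w /uc; exact: iid_law_prod_le.
Qed.

End iid_integrals.

(** * Conditional independence of the candidate sets given the inputs *)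

Section thinning.
Context {d1 d2 : measure_display} {T1 : measurableType d1}
  {T2 : measurableType d2} {R : realType}.
Variable P : probability (T1 * T2)%type R.
Local Open Scope ereal_scope.

Definition tuple_fst n (D : n.-tuple (T1 * T2)) : n.-tuple T1 :=
  [tuple of map fst D].

Lemma measurable_tuple_fst n : measurable_fun setT (@tuple_fst n).
Proof.
apply/measurable_fun_tnthP => i.
rewrite (_ : _ \o _ = fst \o (@tnth n (T1 * T2)%type ^~ i)).
  by apply: measurableT_comp => //; exact: measurable_tnth.
by apply/funext => D /=; rewrite tnth_map.
Qed.

Lemma tuple_fst_cons_pair n (w : T1 * T2) (D : n.-tuple (T1 * T2)) :
  tuple_fst (cons_pair (w, D)) = cons_pair (w.1, tuple_fst D).
Proof. exact: val_inj. Qed.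

(* The density [chi] lowers the conditional mass given the first component by the
   factor [e]; only the marginal on [T1] is seen by the test functions. *)
Definition thins (chi : T1 * T2 -> R) (e : R) :=
  forall G : T1 -> \bar R, measurable_fun setT G -> (forall x, 0 <= G x) ->
    \int[P]_w (G w.1 * (chi w)%:E) <= e%:E * \int[P]_w G w.1.

Lemma iid_law_thin n (F : n.-tuple T1 -> \bar R)
    (chi : 'I_n -> T1 * T2 -> R) (e : 'I_n -> R) :
  measurable_fun setT F -> (forall D, 0 <= F D) ->
  (forall i, measurable_fun setT (chi i)) -> (forall i w, (0 <= chi i w)%R) ->
  (forall i, (0 <= e i)%R) -> (forall i, thins (chi i) (e i)) ->
  \int[iid_law P n]_D (F (tuple_fst D) * (\prod_(i < n) chi i (tnth D i))%:E)
  <= (\prod_(i < n) e i)%:E * \int[iid_law P n]_D F (tuple_fst D).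
Proof.
elim: n F chi e => [|n IH] F chi e mF F0 mchi chi0 e0 chie.
  have mF0 : measurable_fun setT (fun D => F (@tuple_fst 0 D)).
    exact: measurableT_comp mF (@measurable_tuple_fst 0).
  rewrite !iid_law_integral0//; last first.
    by apply: emeasurable_funM => //; exact: measurable_prod_tnth.
  by rewrite !big_ord0 mule1 mul1e.
have mFt : measurable_fun setT (fun D => F (@tuple_fst n.+1 D)).
  exact: measurableT_comp mF (@measurable_tuple_fst _).
(* [F] sees only first components, so after the other pairs are integrated out what remains depends
   on the first component alone: an admissible test function for [thins]. *)
pose G x := \int[iid_law P n]_D F (cons_pair (x, tuple_fst D)).
have mG : measurable_fun setT G.
  pose f (z : T1 * n.-tuple (T1 * T2)) := F (cons_pair (z.1, tuple_fst z.2)).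
  apply: (measurable_fun_fubini_tonelli_F f) => [|z]; last exact: F0.
  apply: (measurableT_comp mF); exact: (measurable_cons measurable_fst
    (measurableT_comp (@measurable_tuple_fst n) measurable_snd)).
have G0 x : 0 <= G x by apply: integral_ge0 => D _; exact: F0.
rewrite !iid_law_integral_cons//; first last.
- by move=> D; rewrite mule_ge0// lee_fin prodr_ge0.
- by apply: emeasurable_funM => //; exact: measurable_prod_tnth.
pose E := (\prod_(i < n) e (lift ord0 i))%R.
have E0 : (0 <= E)%R by exact: prodr_ge0.
apply: (@le_trans _ _ (\int[P]_w (E%:E * (G w.1 * (chi ord0 w)%:E)))).
  apply: le_integral_nonmeasurable => w.
    apply: integral_ge0 => D _; rewrite mule_ge0// lee_fin prodr_ge0//.
  under eq_integral => D _.
    rewrite tuple_fst_cons_pair big_ord_recl tnth_cons_pair0.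
    under eq_bigr do rewrite tnth_cons_pair_lift.
    rewrite EFinM muleCA.
    over.
  rewrite ge0_integralZl//; first last.
  - by rewrite lee_fin.
  - by move=> D _; rewrite mule_ge0// lee_fin prodr_ge0.
  - apply: emeasurable_funM; last first.
      exact: (measurable_prod_tnth (fun i => mchi (lift ord0 i))).
    apply: (measurableT_comp mF).
    exact: measurableT_comp (measurable_cons_pairl _) (@measurable_tuple_fst _).
  rewrite [in leRHS]muleA [leRHS]muleC lee_wpmul2l ?lee_fin//.
  apply: (IH (fun D => F (cons_pair (w.1, D))) (fun i => chi (lift ord0 i))
    (fun i => e (lift ord0 i))) => //.
  exact: measurableT_comp mF (measurable_cons_pairl _).
have mGf : measurable_fun setT (fun w : T1 * T2 => G w.1).
  exact: measurableT_comp mG measurable_fst.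
rewrite ge0_integralZl//; first last.
- by move=> w _; rewrite mule_ge0// lee_fin.
- by apply: emeasurable_funM => //; exact/measurable_EFinP.
rewrite big_ord_recl mulrC EFinM -muleA lee_wpmul2l ?lee_fin//.
under [in leRHS]eq_integral do under eq_integral do rewrite tuple_fst_cons_pair.
exact: chie.
Qed.

End thinning.

(** * Borel structure of a compact metric space *)

Section compact_metric.
Context {R : realType} {X : pmetricType R}.
Hypothesis X_compact : compact [set: X].

Lemma measurable_open (U : set X) : open U -> @measurable _ (borel X) U.
Proof. exact: sub_sigma_algebra. Qed.

Lemma open_mball (x : X) r : open (ball x r).
Proof.
rewrite openE => y; rewrite ballEmdist /interior => /= xy.
apply/nbhs_ballP; exists (r - mdist x y) => /=; first by rewrite subr_gt0.
move=> z; rewrite ballEmdist/= => yz.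
by rewrite (le_lt_trans (metric_triangle _ y _))// -ltrBrDl.
Qed.

Lemma compact_basis_seq : exists B : nat -> set X,
  (forall i, open (B i)) /\
  forall x U, open U -> U x -> exists2 i, B i x & B i `<=` U.
Proof.
have [B cB [Bo Bb]] := compact_second_countable X_compact.
have Bx x U : open U -> U x -> exists2 V, B V /\ V x & V `<=` U.
  by move=> oU Ux; exact: Bb (open_nbhs_nbhs (conj oU Ux)).
case/pfcard_geP: cB => [B0|[g]].
  by have [V []] := Bx point setT openT I; rewrite B0.
exists g; split=> [i|x U oU Ux]; first exact/Bo/funS.
have [V [BV Vx] VU] := Bx x U oU Ux.
by have [i _ giV] := @surj _ _ _ _ g V BV; exists i; rewrite giV.
Qed.

(** The domain carries the product sigma-algebra, so openness in the product topology is not enough: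
    the set where the distance is below [r] is written as a countable union of rectangles of basic
    open sets. *)
Lemma measurable_mdist :
  measurable_fun [set: borel X * borel X] (fun w => mdist w.1 w.2 : R).
Proof.
move=> mT; apply: (measurability _ (RGenInftyO.measurableE R)) => //.
move=> _ [_ [r ->] <-]; rewrite setTI.
have [B [Bo Bb]] := compact_basis_seq.
pose A := [set ij : nat * nat |
  B ij.1 `*` B ij.2 `<=` [set w : X * X | mdist w.1 w.2 < r]].
rewrite (_ : _ @^-1` _ = \bigcup_(ij in A) (B ij.1 `*` B ij.2)).
  rewrite bigcup_mkcond; apply: countable_bigcupT_measurable => [//|ij].
  by case: ifP => // _; apply: measurableX; exact: measurable_open.
apply/seteqP; split => [[x y]/=|[x y] [ij ijA xyB] /=];
  rewrite ?in_itv/=; last exact: (ijA (x, y) xyB).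
move=> xyr; pose e := (r - mdist x y) / 2.
have e0 : 0 < e by rewrite divr_gt0// subr_gt0.
have [i Bix iB] := Bb x (ball x e) (open_mball _ _) (ballxx _ e0).
have [j Bjy jB] := Bb y (ball y e) (open_mball _ _) (ballxx _ e0).
exists (i, j) => //= -[x' y'] /= [/iB + /jB]; rewrite !ballEmdist/= => xx yy.
rewrite (le_lt_trans (metric_triangle _ x _))//.
rewrite (le_lt_trans (lerD (lexx _) (metric_triangle _ y _)))// metric_sym.
rewrite addrCA -ltrBrDl (lt_le_trans (ltrD xx yy))//.
by rewrite -splitr.
Qed.

Lemma closed_msupport (m : set (borel X) -> \bar R) : closed (msupport m).
Proof.
move=> x clx U oU Ux; have [z [zm Uz]] := clx _ (open_nbhs_nbhs (conj oU Ux)).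
exact: zm.
Qed.

(** Each point outside the support lies in a null open set, hence in a null member of the countable
    basis; there are countably many of these. *)
Lemma msupport_full (m : {measure set (borel X) -> \bar R}) :
  m (~` msupport m) = 0%E.
Proof.
have [B [Bo Bb]] := compact_basis_seq.
apply: measure_negligible.
  by apply: measurable_open; apply: closed_openC; exact: closed_msupport.
pose null i : set (borel X) := if m (B i) == 0%E then B i else set0.
have : m.-negligible (\bigcup_i null i).
  apply: negligible_bigcup => i; rewrite /null.
  case: ifPn => [/eqP B0|_]; last exact: negligible_set0.
  by apply/negligibleP => //; exact: measurable_open.
apply: negligibleS => x /existsNP[U /not_implyP[oU /not_implyP[Ux /negP]]].
have mU := measurable_open oU.
rewrite -leNgt measure_le0 => /eqP U0.
have [i Bix iU] := Bb x U oU Ux; exists i => //; rewrite /null ifT//.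
by rewrite -measure_le0 -U0 le_measure// inE//; exact: measurable_open.
Qed.

(** A limit point of the level set lies in [A] and has a point of the level set within [h]. This
    makes the level sets of the optimal predictor on the support Borel. *)
Lemma closed_locconst_level (Y : Type) (f : X -> Y) (A : set X) (h : R) y :
  0 < h -> closed A ->
  (forall x x', A x -> A x' -> mdist x x' < h -> f x = f x') ->
  closed [set x | A x /\ f x = y].
Proof.
move=> h0 cA f_loc x clx; split.
  by apply: cA => U /clx [z [[Az _] Uz]]; exists z.
have Ax : A x by apply: cA => U /clx [z [[Az _] Uz]]; exists z.
have [z [[Az <-] xz]] := clx _ (nbhsx_ballx x h h0).
by apply: f_loc => //; move: xz; rewrite ballEmdist.
Qed.

End compact_metric.

(** * Conditional laws *)

Lemma measurable_fun_discrete (T : pointedType) {d : measure_display}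
    {U : measurableType d} (f : discrete T -> U) : measurable_fun setT f.
Proof. by []. Qed.

Lemma measure_setC_eq0 {d : measure_display} {T : measurableType d}
    {R : realType} (q : {measure set T -> \bar R}) (A : set T) :
  measurable A -> q setT = 1%E -> q A = 1%E -> q (~` A) = 0%E.
Proof.
move=> mA q1 qA; have : q setT = (q A + q (~` A))%E.
  rewrite -(setUCr A); apply: measureU => //; first exact: measurableC.
  exact: setICr.
rewrite q1 qA; case: (q _) => //= r [] /eqP.
by rewrite addrC -subr_eq subrr => /eqP <-.
Qed.

(** * Optimal disambiguation at a single input *)

Section pointwise.
Context {R : realType} {Y : pfinType}.
Local Notation label := (discrete Y).
Local Notation labels := (discrete {set Y}).
Local Open Scope ereal_scope.
Variable ell : Y -> Y -> R.
Hypothesis ell_diag : forall y, ell y y = 0%R.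
Hypothesis ell_proper : forall z y, z != y -> (0 < ell z y)%R.

Lemma compatible_at_dirac (q : {measure set labels -> \bar R}) (y : Y) :
  q setT = 1 -> q [set s : {set Y} | y \notin s] = 0 ->
  compatible_at (\d_(y : label)) q.
Proof.
move=> q1 qy.
(* Normalization only repackages [q], of total mass 1, as a probability; the Dirac mass is the
   default for an impossible case. The coupling is then a product. *)
pose Q : probability labels R := mnormalize q \d_(finset.set0 : labels).
have EQ A : Q A = q A.
  by rewrite /Q /= /mnormalize q1 onee_eq0/= invr1 mule1.
pose pi : probability (label * labels)%type R := (\d_(y : label) \x Q).
have piE A B : pi (A `*` B) = \d_(y : label) A * q B.
  by rewrite -EQ; exact: product_measure1E.
exists pi; split.
- move=> A; rewrite (_ : [set w : label * labels | A w.1] = A `*` setT).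
    by rewrite piE q1 mule1.
  by apply/seteqP; split => [[]|[? ? []]].
- move=> B; rewrite (_ : [set w : label * labels | B w.2] = setT `*` B).
    by rewrite piE diracT mul1e.
  by apply/seteqP; split => [[]|[? ? []]].
- move=> y' s; rewrite (_ : [set (y', s)] = [set y'] `*` [set s]); last first.
    by apply/seteqP; split => [[? ?] [-> ->]|[? ?] /= [-> ->]].
  rewrite piE diracE; have [|_] := boolP (y \in _).
    move=> /set_mem/= <-; rewrite mul1e => qs; apply: contraT => ys.
    suff : q [set s] = 0 by move=> qs0; rewrite qs0 ltxx in qs.
    by apply/eqP; rewrite -measure_le0 -qy le_measure// ?inE// => _ ->.
  by rewrite mul0e ltxx.
Qed.

Lemma pointwise_risk_eq0 (p : {measure set label -> \bar R}) (z : Y) :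
  pointwise_risk ell p z <= 0 -> p [set y | y != z] = 0.
Proof.
move=> pz; have mE := @measurable_fun_discrete Y _ _ (fun y => (ell z y)%:E).
have : \int[p]_(y in setT) `|(ell z y)%:E| = 0.
  under eq_integral do rewrite gee0_abs ?lee_fin ?(ell_ge0 ell_diag ell_proper)//.
  apply/eqP; rewrite eq_le pz integral_ge0// => y _.
  by rewrite lee_fin (ell_ge0 ell_diag ell_proper).
move=> /(ae_eq_integral_abs _ measurableT mE)[N [mN N0 zN]].
apply/eqP; rewrite -measure_le0 -N0 le_measure// ?inE// => y /= yz.
apply: zN => /= /(_ I) [] zy.
by have := @ell_proper z y; rewrite zy ltxx eq_sym yz => /(_ isT).
Qed.

(** Under the coupling, [y] is missing from the candidate set only if the label differs from [y], a
    null event, or at one of finitely many atoms [(y, s)], which the support condition forbids. *)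
Lemma compatible_at_dirac_inv (p : {measure set label -> \bar R})
    (q : {measure set labels -> \bar R}) (y : Y) :
  compatible_at p q -> p [set z | z != y] = 0 ->
  q [set s : {set Y} | y \notin s] = 0.
Proof.
move=> [pi [pi1 pi2 pis]] py.
have mW (A : set (label * labels)) : measurable A.
  apply: countable_measurable => [[z s]|].
    rewrite (_ : [set _] = [set z] `*` [set s]); first exact: measurableX.
    by apply/seteqP; split => [[? ?] [-> ->]|[? ?] /= [-> ->]].
  exact/finite_set_countable/(@finite_finset (Y * {set Y})%type).
rewrite -pi2; apply: measure_negligible; first exact: mW.
apply: (@negligibleS _ (label * labels)%type _ pi
  ([set w | w.1 != y] `|` \big[setU/set0]_(s : {set Y} | y \notin s) [set (y, s)])).
  move=> [z s] /= ys; have [->|zy] := eqVneq z y; last by left.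
  by right; rewrite -bigcup_seq_cond/=; exists s => //=; rewrite mem_index_enum.
apply: negligibleU.
  apply/negligibleP; first exact: mW.
  by have := pi1 [set z | z != y]; rewrite py.
elim/big_rec: _ => [|s A ys A0]; first exact: negligible_set0.
apply: negligibleU A0; apply/negligibleP; first exact: mW.
apply/eqP; rewrite -measure_le0 leNgt; apply/negP => /pis.
by rewrite (negPf ys).
Qed.

Lemma pointwise_optimum (p : {measure set label -> \bar R})
    (q : {measure set labels -> \bar R}) (y z : Y) (eta : R) :
  q setT = 1 -> q [set s : {set Y} | y \in s] = 1 -> (eta < 1)%R ->
  (forall z : Y, z != y -> q [set s : {set Y} | z \in s] <= eta%:E) ->
  argmin [set p | compatible_at p q]
    (fun p => ereal_inf (range (pointwise_risk ell p))) p ->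
  argmin setT (pointwise_risk ell p) z ->
  z = y /\ p [set y' | y' != y] = 0.
Proof.
move=> q1 qy eta1 qz [pq p_min] [_ z_min].
have qC t : q [set s : {set Y} | t \in s] + q [set s : {set Y} | t \notin s] = 1.
  rewrite -measureU//; last by apply/seteqP; split => // s /= [ts]; rewrite ts.
  rewrite -q1; congr (q _); apply/seteqP; split => // s _ /=.
  by case: (t \in s); [left|right].
have qyC : q [set s : {set Y} | y \notin s] = 0.
  apply: etrans (measure_setC_eq0 _ q1 qy) => //; congr (q _).
  by apply/seteqP; split => s /= /negP.
have pz0 : pointwise_risk ell p z <= 0.
  have zinf : pointwise_risk ell p z <= ereal_inf (range (pointwise_risk ell p)).
    by apply: le_ereal_inf_tmp => _ [t _ <-]; exact: z_min.
  apply: (le_trans zinf).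
  have cd := compatible_at_dirac q1 qyC.
  apply: (le_trans (p_min _ cd)); apply: ereal_inf_lbound; exists y => //.
  by rewrite /pointwise_risk integral_dirac// diracT mul1e ell_diag.
have pz := pointwise_risk_eq0 pz0.
have qzC := compatible_at_dirac_inv pq pz.
(* [z] is a candidate with conditional probability 1, whereas labels other than [y] have probability
   at most [eta < 1]. *)
suff zy : z = y by split=> //; rewrite -zy.
apply/eqP/negPn/negP => /qz.
have := qC z; rewrite qzC adde0 => ->.
by rewrite lee_fin leNgt eta1.
Qed.

End pointwise.

(** * From conditional laws to joint laws *)

Section conditional_law_bounds.
Context {d1 d2 : measure_display} {T1 : measurableType d1}
  {T2 : measurableType d2} {R : realType}.
Variables (rho : probability (T1 * T2)%type R) (kappa : R.-pker T1 ~> T2).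
Hypothesis rho_kappa : conditional_law rho kappa.
Local Open Scope ereal_scope.

Lemma fst_marginalE (B : set T1) :
  measurable B -> fst_marginal rho B = rho (B `*` setT).
Proof.
move=> mB; rewrite /fst_marginal /= /pushforward; congr (rho _).
by apply/seteqP; split => [[? ?]|[? ?] []].
Qed.

Lemma conditional_law_le (B : set T1) (C : set T2) (e : R) :
  measurable B -> measurable C -> (0 <= e)%R ->
  (forall x, B x -> kappa x C <= e%:E) ->
  rho (B `*` C) <= e%:E * fst_marginal rho B.
Proof.
move=> mB mC e0 kC; rewrite rho_kappa// -integral_cst//.
apply: ge0_le_integral => //.
by apply: measurable_funTS; exact: measurable_kernel.
Qed.

Lemma integral_mrestr_ge (D : set (T1 * T2)) (mD : measurable D)
    (g : T1 * T2 -> \bar R) :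
  measurable_fun setT g -> (forall w, 0 <= g w) ->
  \int[rho]_w (g w * (\1_D w)%:E) <= \int[mrestr rho mD]_w g w.
Proof.
move=> mg g0.
have mgD : measurable_fun setT (fun w => g w * (\1_D w)%:E).
  by apply: emeasurable_funM => //; exact/measurable_EFinP.
have gD0 w : 0 <= g w * (\1_D w)%:E by rewrite mule_ge0// lee_fin.
have mDC : measurable (~` D) by exact: measurableC.
rewrite (@eq_measure_integral _ _ _ _
  (measure_add (mrestr rho mD) (mrestr rho mDC))); last first.
  move=> A mA _; apply: etrans (esym (measure_addE _ _ A)).
  transitivity (rho ((A `&` D) `|` (A `&` ~` D))).
    by rewrite -setIUr setUCr setIT.
  apply: measureU; [exact: measurableI|exact: measurableI|].
  by rewrite setIACA setICr setI0.
rewrite ge0_integral_measure_add//.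
rewrite [X in _ + X](_ : _ = 0) ?adde0.
  apply: le_integral_nonmeasurable => // w.
  by rewrite indicE; case: (_ \in _); rewrite ?mule1 ?mule0.
rewrite -(@integral0 _ _ _ (mrestr rho mDC) setT).
apply: ge0_ae_eq_integral => //; exists D; split => //.
  by have : rho (D `&` ~` D) = 0 by rewrite setICr measure0.
move=> w /= /not_implyP[_]; apply: contra_notP => Dw.
by rewrite indicE memNset// mule0.
Qed.

(** The law restricted to the rectangle, pushed to the first component, is dominated set by set by
    [e] times the marginal; integrals of nonnegative functions inherit the comparison. *)
Lemma conditional_law_thins (B : set T1) (C : set T2) (e : R) :
  measurable B -> measurable C -> (0 <= e)%R ->
  (forall x, B x -> kappa x C <= e%:E) ->
  thins rho (\1_(B `*` C)) e.
Proof.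
move=> mB mC e0 kC G mG G0.
have mBC : measurable (B `*` C) by exact: measurableX.
have mGf : measurable_fun setT (fun w : T1 * T2 => G w.1).
  exact: measurableT_comp mG measurable_fst.
apply: le_trans (integral_mrestr_ge mBC mGf _) _ => [w|]; first exact: G0.
have -> : \int[mrestr rho mBC]_w G w.1 =
    \int[pushforward (mrestr rho mBC) fst]_x G x.
  by rewrite ge0_integral_pushforward.
have -> : \int[rho]_w G w.1 = \int[fst_marginal rho]_x G x.
  by rewrite ge0_integral_distribution.
pose en : {nonneg R} := NngNum e0.
rewrite -(ge0_integral_mscale _ _ en)//.
apply: ge0_le_measure_integral => // A mA.
rewrite -[leLHS]/(rho ((fst @^-1` A) `&` (B `*` C))).
rewrite -[leRHS]/(e%:E * fst_marginal rho A).
have -> : (fst @^-1` A) `&` (B `*` C) = (A `&` B) `*` C.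
  by apply/seteqP; split => [[? ?] [? []]|[? ?] [[? ?] ?]].
apply: (@le_trans _ _ (e%:E * fst_marginal rho (A `&` B))).
  by apply: conditional_law_le => // [|x [_]]; [exact: measurableI|exact: kC].
rewrite lee_wpmul2l ?lee_fin// le_measure ?inE//.
exact: measurableI.
Qed.

(** Cutting along the finitely many level sets of [f] turns the exceptional set into finitely many
    null rectangles, to which the defining identity of the conditional law applies. *)
Lemma conditional_law_ae (Y : finType) (f : T1 -> Y) (A : set T1) (C : Y -> set T2) :
  fst_marginal rho (~` A) = 0 ->
  (forall y, measurable (A `&` [set x | f x = y])) ->
  (forall y, measurable (C y)) ->
  (forall x, A x -> kappa x (~` C (f x)) = 0) ->
  {ae rho, forall w, A w.1 /\ C (f w.1) w.2}.
Proof.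
move=> A0 mS mC kC.
have mA : measurable A.
  have -> : A = \big[setU/set0]_y (A `&` [set x | f x = y]).
    rewrite -bigcup_seq; apply/seteqP; split => [x Ax|x [y _ []//]].
    by exists (f x); rewrite /= ?mem_index_enum.
  exact: bigsetU_measurable.
have null_level y : rho.-negligible ((A `&` [set x | f x = y]) `*` ~` C y).
  apply/negligibleP; first by apply: measurableX => //; exact: measurableC.
  apply/eqP; rewrite -measure_le0 -[leRHS](mul0e (fst_marginal rho
    (A `&` [set x | f x = y]))).
  apply: conditional_law_le => //; first exact: measurableC.
  by move=> x [Ax <-]; rewrite kC.
have null_out : rho.-negligible (~` A `*` setT).
  apply/negligibleP; first by apply: measurableX => //; exact: measurableC.
  by apply: etrans (esym (fst_marginalE _)) A0; exact: measurableC.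
apply: (@negligibleS _ _ _ _ ((~` A `*` setT) `|`
    \big[setU/set0]_y ((A `&` [set x | f x = y]) `*` ~` C y))).
  move=> [x z] /= /not_andP[nA|nC]; first by left.
  have [Ax|nA] := pselect (A x); last by left.
  by right; rewrite -bigcup_seq; exists (f x) => //=; rewrite mem_index_enum.
apply: negligibleU => //; elim/big_rec: _ => [|y S _ S0].
  exact: negligible_set0.
exact: negligibleU.
Qed.

End conditional_law_bounds.

Lemma iid_law_ae {d : measure_display} {T : measurableType d} {R : realType}
    (P : probability T R) (Q : T -> Prop) n :
  {ae P, forall w, Q w} -> {ae iid_law P n, forall D, forall i, Q (tnth D i)}.
Proof.
move=> [N [mN N0 QN]].
apply: filter_forall => i.
have mNi : measurable [set D : n.-tuple T | N (tnth D i)].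
  by rewrite -[X in measurable X]setTI; exact: measurable_tnth.
exists [set D | N (tnth D i)]; split => // [|D /QN//].
set Ni := [set D : n.-tuple T | _] in mNi *.
have <- : (\int[iid_law P n]_D (\1_Ni D)%:E = iid_law P n Ni)%E.
  by rewrite integral_indic// setIT.
apply/eqP; rewrite eq_le integral_ge0 ?andbT; last by move=> D _; rewrite lee_fin.
have <- : ((1 ^+ n.-1)%:E * \int[P]_w (\1_N w)%:E = 0 :> \bar R)%E.
  rewrite [X in (_ * X)%E](_ : _ = 0%E) ?mule0//.
  by apply: etrans N0; rewrite integral_indic// setIT.
(* With trivial pair factors, the marked-point bound controls the law of the single coordinate
   [i]. *)
apply: le_trans (@iid_law_prod_pair_le _ _ _ P (fun _ _ => 1) 1 n i (\1_N)
  _ _ _ _ _ _) => //; last first.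
  by move=> w _; rewrite integral_cst// mul1e probability_le1.
rewrite le_eqVlt; apply/orP; left; apply/eqP; apply: eq_integral => D _.
rewrite (bigD1 i)//= eqxx big1 => [|j /negPf->//].
by rewrite mulr1 !indicE.
Qed.

Lemma ae_fst_marginal {d1 d2 : measure_display} {T1 : measurableType d1}
    {T2 : measurableType d2} {R : realType} (rho : probability (T1 * T2)%type R)
    (Q : T1 -> Prop) :
  {ae fst_marginal rho, forall x, Q x} -> {ae rho, forall w, Q w.1}.
Proof.
move=> [N [mN N0 QN]]; exists (fst @^-1` N); split => //.
  by rewrite -[X in measurable X]setTI; exact: measurable_fst.
by move=> w /= Qw; exact: QN.
Qed.

Lemma integral_probability_cst {d : measure_display} {T : measurableType d}
    {R : realType} (P : probability T R) (r : \bar R) : (\int[P]_x r = r)%E.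
Proof.
rewrite integral_cst// -[RHS]mule1; congr (_ * _)%E.
exact: probability_setT.
Qed.

(** * The dominating function and its expectation *)

Section measurable_nearest.
Context {R : realType} {X : pmetricType R} {d : measure_display}
  {S : measurableType d}.
Hypothesis X_compact : compact [set: X].
Variables (n k : nat) (xs : 'I_n -> S -> borel X) (g : S -> borel X).
Hypothesis mxs : forall i, measurable_fun setT (xs i).
Hypothesis mg : measurable_fun setT g.

Lemma measurable_natr_bool (b : S -> bool) :
  measurable_fun setT b -> measurable_fun setT (fun t => (b t)%:R : R).
Proof.
move=> mb; rewrite (_ : (fun _ => _) = fun t => if b t then 1 else 0 : R).
  exact: measurable_fun_ifT.
by apply/funext => t; case: (b t).
Qed.

Lemma measurable_nearest i : measurable_fun setT
  (fun t => i \in nearest k (fun j => mdist (g t) (xs j t) : R)).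
Proof.
have md j : measurable_fun setT (fun t => mdist (g t) (xs j t) : R).
  exact: measurableT_comp (measurable_mdist X_compact)
    (measurable_fun_pair mg (mxs j)).
rewrite (_ : (fun _ => _) = fun t =>
  \sum_(j < n) (mdist (g t) (xs j t) <= mdist (g t) (xs i t) :> R)%R%:R <= k%:R :> R).
  apply: measurable_fun_ler => //; apply: measurable_sum => j.
  exact/measurable_natr_bool/measurable_fun_ler.
apply/funext => t; rewrite inE -natr_sum ler_nat /rank -sum1_card.
by rewrite big_mkcond/=; congr (_ <= _)%N; apply: eq_bigr => j _; rewrite inE; case: ifP.
Qed.

Lemma measurable_knn_weight i :
  measurable_fun setT (fun t => knn_weight k (fun j => xs j t) (g t) i : R).
Proof.
under eq_fun do rewrite knn_weightE.
by apply: measurable_fun_ifT => //; exact: measurable_nearest.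
Qed.

Lemma measurable_nearest_eq (J : {set 'I_n}) : measurable_fun setT
  (fun t => (nearest k (fun j => mdist (g t) (xs j t) : R) == J)%:R : R).
Proof.
rewrite (_ : (fun _ => _) = fun t => \prod_(i < n)
  (if i \in J then (i \in nearest k (fun j => mdist (g t) (xs j t) : R))%:R
   else if i \in nearest k (fun j => mdist (g t) (xs j t) : R) then 0 else 1)).
  apply: measurable_prod => i _; case: (i \in J).
    exact/measurable_natr_bool/measurable_nearest.
  by apply: measurable_fun_ifT => //; exact: measurable_nearest.
apply/funext => t; set N := nearest _ _.
have [->|NJ] := eqVneq N J.
  by rewrite big1// => i _; case: (i \in J).
have [i iNJ] : exists i, (i \in N) != (i \in J).
  apply/existsP; apply: contraNT NJ; rewrite negb_exists => /forallP NJ.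
  by apply/eqP/setP => i; apply/eqP; rewrite -[_ == _]negbK; exact: NJ.
by rewrite (bigD1 i)//=; move: iNJ; case: (i \in J); case: (i \in N) => //; rewrite mul0r.
Qed.

End measurable_nearest.

(** * A measurable upper bound for the loss at a test point *)

Section dominating_function.
Context {R : realType} {X : pmetricType R} {Y : pfinType}.
Local Notation input := (borel X).
Local Notation labels := (discrete {set Y}).
Local Notation T := (input * labels)%type.
Hypothesis X_compact : compact [set: X].
Variables (ell : Y -> Y -> R) (C : R).
Hypothesis ell_diag : forall y, ell y y = 0.
Hypothesis ell_proper : forall z y, z != y -> 0 < ell z y.
Hypothesis ell_le : forall z y, ell z y <= C.
Variables (f : X -> Y) (A : set X) (h : R).
Hypothesis h_gt0 : 0 < h.
Hypothesis mA : measurable (A : set input).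
Hypothesis f_locconst :
  forall x x', A x -> A x' -> mdist x x' < h -> f x = f x'.
Hypothesis mB : forall z, measurable (A `&` [set x | f x <> z] : set input).
Variables (n k : nat).
Hypothesis k_gt0 : (0 < k)%N.

(* [2 ^+ k] times the product of the discounts dominates the indicator of the
   event that fewer than [k] sample points are within distance [h] of [x], and
   its expectation factorizes over the sample. *)
Definition discount (x x' : X) : R := if mdist x x' < h then 2^-1 else 1.

Definition mislabel (z : Y) : T -> R :=
  \1_((A `&` [set x | f x <> z]) `*` [set s : {set Y} | z \in s]).

Definition test_sparse (D : n.-tuple T) (x : X) : R :=
  2 ^+ k * \prod_(j < n) discount x (tnth D j).1.

(** The factor of [i] itself is the discount at distance 0, times an indicator of [A], so that the
    ball masses need a lower bound only at centers in [A]. *)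
Definition train_sparse (D : n.-tuple T) (i : 'I_n) : R :=
  2 ^+ k * \prod_(j < n) (if j == i then 2^-1 * \1_A (tnth D i).1
                          else discount (tnth D i).1 (tnth D j).1).

(* The weight of the neighbor [q.1] of [x], on the event that its neighborhood is
   [q.2]. *)
Definition weight_on (Xs : n.-tuple input) (x : X) (q : 'I_n * {set 'I_n}) : R :=
  knn_weight k (fun j => tnth Xs j) x q.1 *
  ((nearest k (fun j => mdist (tnth Xs q.1 : X) (tnth Xs j)) == q.2)%:R *
   (#|q.2| == k)%:R).

(** The index set [J] is fixed instead of being the random neighborhood, so the factors involve
    separate, independent sample points. *)
Definition misled_on (D : n.-tuple T) (z : Y) (J : {set 'I_n}) : R :=
  \prod_(j < n) (if j \in J then mislabel z (tnth D j) else 1).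

Definition dominating (D : n.-tuple T) (x : X) : R :=
  C * (test_sparse D x + \sum_(i < n) train_sparse D i) +
  2 * C * \sum_z \sum_q weight_on (tuple_fst D) x q * misled_on D z q.2.

Lemma loss_bound_ge0 : 0 <= C.
Proof. by rewrite (le_trans _ (ell_le point point))// ell_diag. Qed.

Lemma discount_ge0 x x' : 0 <= discount x x'.
Proof. by rewrite /discount; case: ifP. Qed.

Lemma mislabel_ge0 z w : 0 <= mislabel z w.
Proof. by rewrite /mislabel indicE. Qed.

Lemma test_sparse_ge0 D x : 0 <= test_sparse D x.
Proof. by rewrite mulr_ge0// prodr_ge0// => j _; exact: discount_ge0. Qed.

Lemma train_sparse_ge0 D i : 0 <= train_sparse D i.
Proof.
rewrite mulr_ge0// prodr_ge0// => j _; case: ifP => _; last exact: discount_ge0.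
by rewrite mulr_ge0// indicE.
Qed.

Lemma weight_on_ge0 Xs x q : 0 <= weight_on Xs x q.
Proof. by rewrite mulr_ge0 ?knn_weight_ge0. Qed.

Lemma misled_on_ge0 D z J : 0 <= misled_on D z J.
Proof. by rewrite prodr_ge0// => j _; case: ifP => // _; exact: mislabel_ge0. Qed.

(** For each [i] only one [J] is the actual neighborhood, so summing over all subsets of indices
    costs nothing beyond the total neighbor weight. *)
Lemma sum_weight_on_le1 Xs x : \sum_q weight_on Xs x q <= 1.
Proof.
rewrite -(pair_bigA _ (fun i J => weight_on Xs x (i, J)))/=.
apply: le_trans (sum_knn_weight_le1 k (fun j => tnth Xs j) x).
apply: ler_sum => i _; rewrite /weight_on/= -mulr_sumr.
rewrite ler_piMr ?knn_weight_ge0//.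
rewrite (bigD1 (nearest k (fun j => mdist (tnth Xs i : X) (tnth Xs j))))//= eqxx mul1r.
rewrite big1 ?addr0 => [|J /negPf JN]; first by case: eqP.
by rewrite eq_sym JN mul0r.
Qed.

Lemma discount_prod x (xs : 'I_n -> X) :
  (#|[pred j | (mdist x (xs j) < h)%R]| < k)%N ->
  1 <= 2 ^+ k * \prod_(j < n) discount x (xs j) :> R.
Proof.
move=> xk; rewrite /discount -big_mkcond/= prodr_const exprVn.
rewrite ler_pdivlMr ?exprn_gt0// mul1r ler_eXn2l ?ltr1n//.
exact: ltnW.
Qed.

(** If the ball of [x] or of a sample point is sparse, one sparsity term is at least 1 and the loss
    is at most [C]. Otherwise the deterministic error bound applies, and each misled neighbor is
    charged to its own neighborhood and one wrong label. *)
Lemma knn_estimator_le_dominating D (g : X -> Y) x :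
  (forall i, A (inputs D i) /\ f (inputs D i) \in candidates D i) ->
  (forall i, injective (fun j => mdist (inputs D i) (inputs D j))) ->
  A x -> injective (fun j => mdist x (inputs D j)) ->
  knn_estimator ell k (inputs D) (candidates D) g ->
  ell (g x) (f x) <= dominating D x.
Proof.
move=> DA D_inj Ax x_inj gP; have C0 := loss_bound_ge0.
have S0 : 0 <= 2 * C * \sum_z \sum_q weight_on (tuple_fst D) x q * misled_on D z q.2.
  rewrite mulr_ge0 ?mulr_ge0// sumr_ge0// => z _; rewrite sumr_ge0// => q _.
  by rewrite mulr_ge0 ?weight_on_ge0 ?misled_on_ge0.
have tr0 : 0 <= \sum_(i < n) train_sparse D i.
  by rewrite sumr_ge0// => i _; exact: train_sparse_ge0.
rewrite /dominating.
have [x_sparse|x_dense] := ltnP #|[pred j | (mdist x (inputs D j) < h)%R]| k.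
  rewrite (le_trans (ell_le _ _))// -[leLHS]addr0 lerD// -[leLHS]mulr1 ler_wpM2l//.
  by rewrite (le_trans (discount_prod x_sparse))// lerDl.
have [/existsP[i i_sparse]|] := boolP
    [exists i, (#|[pred j | (mdist (inputs D i) (inputs D j) < h)%R]| < k)%N].
  rewrite (le_trans (ell_le _ _))// -[leLHS]addr0 lerD// -[leLHS]mulr1 ler_wpM2l//.
  rewrite (le_trans (discount_prod i_sparse))// -[leLHS]add0r lerD ?test_sparse_ge0//.
  rewrite [leRHS](bigD1 i)//= -[leLHS]addr0 lerD//; last first.
    by rewrite sumr_ge0// => j _; exact: train_sparse_ge0.
  rewrite /train_sparse ler_wpM2l// le_eqVlt; apply/orP; left; apply/eqP.
  apply: eq_bigr => j _; case: eqP => [->|//].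
  by rewrite indicE mem_set ?mulr1 /discount ?mdistxx ?h_gt0//; case: (DA i).
rewrite negb_exists => /forallP D_dense.
have {}D_dense i : (k <= #|[pred j | (mdist (inputs D i) (inputs D j) < h)%R]|)%N.
  by rewrite leqNgt; exact: D_dense.
apply: le_trans (knn_estimator_error ell_diag ell_proper ell_le f_locconst k_gt0
  (fun i => (DA i).1) (fun i => (DA i).2) D_inj D_dense Ax x_inj x_dense gP) _.
rewrite -[leLHS]add0r lerD ?mulr_ge0 ?addr_ge0 ?test_sparse_ge0//.
rewrite ler_wpM2l ?mulr_ge0// exchange_big/=.
rewrite -(pair_bigA _ (fun i J => \sum_z weight_on (tuple_fst D) x (i, J) *
   misled_on D z J))/=.
have inputsE : (fun j => tnth (tuple_fst D) j) = inputs D.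
  by apply/funext => j; rewrite tnth_map.
apply: ler_sum => i _; set N := nearest k (fun j => mdist (inputs D i) (inputs D j)).
have Nk : #|N| = k.
  apply: card_nearest; first exact: D_inj.
  by rewrite (leq_trans (D_dense i))// (leq_trans (max_card _))// card_ord.
rewrite [leRHS](bigD1 N)//= -[leLHS]addr0 lerD//; last first.
  rewrite sumr_ge0// => J _; rewrite sumr_ge0// => z _.
  by rewrite mulr_ge0 ?weight_on_ge0 ?misled_on_ge0.
have -> : weight_on (tuple_fst D) x (i, N) = knn_weight k (inputs D) x i.
  rewrite /weight_on/= inputsE (_ : nearest _ _ = N) ?eqxx ?Nk ?eqxx ?mulr1//.
  by congr (nearest k _); apply/funext => j; rewrite !tnth_map.
rewrite -mulr_sumr ler_wpM2l ?knn_weight_ge0//.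
rewrite /misled; case: existsP => [[z /forall_inP zN]|_]; last first.
  by rewrite sumr_ge0// => z _; exact: misled_on_ge0.
rewrite [leRHS](bigD1 z)//= -[leLHS]addr0 lerD//; last first.
  by rewrite sumr_ge0// => z' _; exact: misled_on_ge0.
rewrite /misled_on big1// => j _; case: ifPn => // /zN/andP[zj fj].
by rewrite /mislabel indicE mem_set//=; split => //; split; [case: (DA j)|exact/eqP].
Qed.

Lemma measurable_discount :
  measurable_fun setT (fun w : input * input => discount w.1 w.2).
Proof.
apply: measurable_fun_ifT => //; apply: measurable_fun_ltr => //.
exact: measurable_mdist.
Qed.

Lemma measurable_mislabel z : measurable_fun setT (mislabel z).
Proof. by apply: measurable_indic; apply: measurableX. Qed.

Local Notation sample := (n.-tuple T).

Let measurable_input i :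
  measurable_fun setT (fun v : sample * input => (tnth v.1 i).1).
Proof.
apply: (measurableT_comp measurable_fst).
exact: (measurableT_comp (measurable_tnth i) measurable_fst).
Qed.

Lemma measurable_test_sparse :
  measurable_fun setT (fun v : sample * input => test_sparse v.1 v.2).
Proof.
apply: measurable_funM => //; apply: measurable_prod => j _.
exact: measurableT_comp measurable_discount
  (measurable_fun_pair measurable_snd (measurable_input j)).
Qed.

Lemma measurable_train_sparse i :
  measurable_fun setT (fun v : sample * input => train_sparse v.1 i).
Proof.
apply: measurable_funM => //; apply: measurable_prod => j _.
case: (j == i).
  apply: measurable_funM => //; apply: measurableT_comp (measurable_input i).
  exact: measurable_indic.
exact: measurableT_comp measurable_discount
  (measurable_fun_pair (measurable_input i) (measurable_input j)).
Qed.

Lemma measurable_weight_on q : measurable_fun setT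
  (fun v : n.-tuple input * input => weight_on v.1 v.2 q).
Proof.
have mt i : measurable_fun setT (fun v : n.-tuple input * input => tnth v.1 i).
  exact: (measurableT_comp (measurable_tnth i) measurable_fst).
apply: measurable_funM; first exact: measurable_knn_weight.
by apply: measurable_funM => //; exact: measurable_nearest_eq.
Qed.

Lemma measurable_weight_on_inputs q : measurable_fun setT
  (fun v : sample * input => weight_on (tuple_fst v.1) v.2 q).
Proof.
apply: (measurableT_comp (measurable_weight_on q)
  (measurable_fun_pair _ measurable_snd)).
exact: (measurableT_comp (@measurable_tuple_fst _ _ _ _ n) measurable_fst).
Qed.

Lemma measurable_misled_on z J :
  measurable_fun setT (fun v : sample * input => misled_on v.1 z J).
Proof.
apply: measurable_prod => j _; case: (j \in J) => //.
apply: (measurableT_comp (measurable_mislabel z)).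
exact: (measurableT_comp (measurable_tnth j) measurable_fst).
Qed.

Lemma measurable_dominating :
  measurable_fun setT (fun v : sample * input => dominating v.1 v.2).
Proof.
apply: measurable_funD; apply: measurable_funM => //.
  apply: measurable_funD; first exact: measurable_test_sparse.
  by apply: measurable_sum => i; exact: measurable_train_sparse.
apply: measurable_sum => z; apply: measurable_sum => q; apply: measurable_funM.
  exact: measurable_weight_on_inputs.
exact: measurable_misled_on.
Qed.

Lemma dominating_ge0 D x : 0 <= dominating D x.
Proof.
have C0 := loss_bound_ge0; rewrite addr_ge0// mulr_ge0 ?mulr_ge0//.
  rewrite addr_ge0 ?test_sparse_ge0// sumr_ge0// => i _.
  exact: train_sparse_ge0.
rewrite sumr_ge0// => z _; rewrite sumr_ge0// => q _.
by rewrite mulr_ge0 ?weight_on_ge0 ?misled_on_ge0.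
Qed.

Variables (nu : probability T R) (p eta : R).
Hypothesis p_le1 : p <= 1.
Hypothesis ball_mass : forall x, A x -> (p%:E <= fst_marginal nu (ball x h))%E.
Hypothesis eta_ge0 : 0 <= eta.
Hypothesis mislabel_thins : forall z, thins nu (mislabel z) eta.

Local Notation mean F := (\int[iid_law nu n]_D (F D)%:E)%E.
Local Notation c := (1 - 2^-1 * p).

Let c_ge0 : 0 <= c. Proof. by move: p_le1; lra. Qed.

Lemma measurable_discount_fst (x : X) :
  measurable_fun setT (fun w : T => discount x w.1).
Proof.
exact: (measurableT_comp (measurableT_comp measurable_discount
  (measurable_pair1 (x : input))) measurable_fst).
Qed.

Lemma integral_discount_le x : A x ->
  (\int[nu]_w (discount x w.1)%:E <= c%:E)%E.
Proof.
move=> Ax; pose b : set T := fst @^-1` (ball x h : set input).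
have mb : measurable b.
  rewrite -[b]setTI; apply: measurable_fst => //.
  by apply: measurable_open; exact: open_mball.
have -> : (\int[nu]_w (discount x w.1)%:E =
    \int[nu]_w (1 - (2^-1)%:E * (\1_b w)%:E))%E.
  apply: eq_integral => w _; rewrite /discount indicE /b -EFinM -EFinB.
  case: ifPn => xy.
    rewrite mem_set; last by rewrite /= ballEmdist.
    congr EFin; rewrite mulr1; lra.
  by rewrite memNset ?mulr0 ?subr0//= ballEmdist/=; exact/negP.
rewrite integralB//; last 2 first.
- exact: finite_measure_integrable_cst.
- apply: integrableZl => //; exact: integrable_indic.
rewrite integral_probability_cst integralZl//; last exact: integrable_indic.
rewrite integral_indic// setIT EFinB EFinM leeB// lee_wpmul2l//.
exact: ball_mass.
Qed.

Lemma integral_test_sparse_le x : A x ->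
  (mean (test_sparse^~ x) <= (2 ^+ k * c ^+ n)%:E)%E.
Proof.
move=> Ax; have d0 w : 0 <= discount x w by exact: discount_ge0.
under eq_integral do rewrite EFinM.
rewrite ge0_integralZl//; last 2 first.
- exact: (measurable_prod_tnth (fun=> measurable_discount_fst x)).
- by move=> D _; rewrite lee_fin prodr_ge0.
rewrite EFinM lee_wpmul2l ?lee_fin//.
apply: (iid_law_prod_le n (measurable_discount_fst x)) => //.
exact: integral_discount_le.
Qed.

Lemma integral_train_sparse_le i :
  (mean (train_sparse^~ i) <= (2 ^+ k * c ^+ n)%:E)%E.
Proof.
pose a (w : T) := 2^-1 * \1_A w.1 : R.
pose u (w w' : T) := discount w.1 w'.1.
have ma : measurable_fun setT a.
  apply: measurable_funM => //; apply: measurableT_comp measurable_fst.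
  exact: measurable_indic.
have mu : measurable_fun setT (fun w : T * T => u w.1 w.2).
  exact: (measurableT_comp measurable_discount (measurable_fun_pair
    (measurableT_comp measurable_fst measurable_fst)
    (measurableT_comp measurable_fst measurable_snd))).
under eq_integral do rewrite EFinM.
rewrite ge0_integralZl//; last 2 first.
- exact: measurable_prod_pair_tnth ma mu.
- move=> D _; rewrite lee_fin prodr_ge0// => j _; case: ifP => _.
    by rewrite mulr_ge0// indicE.
  exact: discount_ge0.
rewrite EFinM lee_wpmul2l ?lee_fin//.
apply: le_trans (iid_law_prod_pair_le i mu _ c_ge0 ma _ _) _.
- by move=> w w'; exact: discount_ge0.
- by move=> w; rewrite mulr_ge0// indicE.
- move=> w; rewrite mulf_eq0 negb_or indicE pnatr_eq0 eqb0 negbK => /andP[_ /set_mem].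
  exact: integral_discount_le.
(* The other points give only [n.-1] factors. The marked point supplies the last one, since its
   discount [2^-1] is at most [c] when [p <= 1]. *)
have -> : c ^+ n = c ^+ n.-1 * c.
  by rewrite -exprSr prednK// (leq_ltn_trans _ (ltn_ord i)).
rewrite EFinM lee_wpmul2l ?lee_fin ?exprn_ge0//.
apply: (@le_trans _ _ (\int[nu]_w (2^-1)%:E)%E).
  apply: le_integral_nonmeasurable => w; rewrite lee_fin.
    by rewrite mulr_ge0// indicE.
  by rewrite /a indicE; case: (_ \in _); rewrite ?mulr1 ?mulr0.
rewrite integral_probability_cst lee_fin.
by move: p_le1; lra.
Qed.

(** The weight depends on the inputs only, so thinning the points of the fixed set [q.2] gives one
    factor [eta] each. Unless that set has [k] elements, the weight vanishes. *)
Lemma integral_misled_on_le x z q :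
  (mean (fun D => weight_on (tuple_fst D) x q * misled_on D z q.2)%R
   <= (eta ^+ k)%:E * mean (fun D => weight_on (tuple_fst D) x q))%E.
Proof.
have [qk|qk] := eqVneq #|q.2| k; last first.
  under eq_integral do rewrite /weight_on (negPf qk) !mulr0 mul0r.
  by rewrite integral0 mule_ge0 ?lee_fin ?exprn_ge0// integral_ge0// => D _;
    rewrite lee_fin weight_on_ge0.
under eq_integral do rewrite EFinM.
pose chi (j : 'I_n) : T -> R := if j \in q.2 then mislabel z else cst 1.
pose e (j : 'I_n) : R := if j \in q.2 then eta else 1.
have -> : eta ^+ k = \prod_(j < n) e j.
  by rewrite /e -big_mkcond/= prodr_const qk.
have E D : misled_on D z q.2 = \prod_(j < n) chi j (tnth D j).
  by apply: eq_bigr => j _; rewrite /chi; case: ifP.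
under eq_integral do rewrite E.
apply: (@iid_law_thin _ _ _ _ _ nu n (fun Xs => (weight_on Xs x q)%:E) chi e).
- apply/measurable_EFinP.
  exact: (measurableT_comp (measurable_weight_on q) (measurable_pair2 (x : input))).
- by move=> Xs; rewrite lee_fin weight_on_ge0.
- move=> j; rewrite /chi; case: ifP => // _; exact: measurable_mislabel.
- by move=> j w; rewrite /chi; case: ifP => // _; exact: mislabel_ge0.
- by move=> j; rewrite /e; case: ifP.
- move=> j; rewrite /chi /e; case: ifP => [_|_]; first exact: mislabel_thins.
  by move=> G mG G0; rewrite mul1e; under eq_integral do rewrite mule1.
Qed.

Lemma integral_misled_le x :
  (mean (fun D => \sum_z \sum_q weight_on (tuple_fst D) x q * misled_on D z q.2)%R
    <= (#|Y|%:R * eta ^+ k)%:E)%E.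
Proof.
have mwR q : measurable_fun setT (fun D : sample => weight_on (tuple_fst D) x q).
  exact: (measurableT_comp (measurable_weight_on_inputs q) (measurable_pair2 (x : input))).
have mw q : measurable_fun setT
    (fun D : sample => (weight_on (tuple_fst D) x q)%:E).
  exact/measurable_EFinP.
have mt z q : measurable_fun setT (fun D : sample =>
    (weight_on (tuple_fst D) x q * misled_on D z q.2)%:E).
  apply/measurable_EFinP; apply: (measurable_funM (mwR q)).
  exact: (measurableT_comp (measurable_misled_on z q.2) (measurable_pair2 (x : input))).
have t0 z q (D : sample) : (0 <= (weight_on (tuple_fst D) x q * misled_on D z q.2)%:E)%E.
  by rewrite lee_fin mulr_ge0 ?weight_on_ge0 ?misled_on_ge0.
under eq_integral do rewrite -sumEFin.
rewrite ge0_integral_sum//; last 2 first.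
- by move=> z; under eq_fun do rewrite -sumEFin; exact: emeasurable_sum.
- move=> z D _; rewrite -sumEFin; exact: sume_ge0.
(* The number of labels comes from the union bound over the wrong label; the sum over neighborhoods
   is absorbed by the total weight. *)
have -> : (#|Y|%:R * eta ^+ k)%:E = (\sum_(z : Y) (eta ^+ k)%:E)%E.
  by rewrite sumEFin sumr_const mulr_natl.
apply: lee_sum => z _.
under eq_integral do rewrite -sumEFin.
rewrite ge0_integral_sum//.
apply: (@le_trans _ _ (\sum_q (eta ^+ k)%:E *
    mean (fun D => weight_on (tuple_fst D) x q))%E).
  by apply: lee_sum => q _; exact: integral_misled_on_le.
rewrite -ge0_sume_distrr; last first.
  by move=> q _; apply: integral_ge0 => D _; rewrite lee_fin weight_on_ge0.
rewrite -[leRHS]mule1 lee_wpmul2l ?lee_fin ?exprn_ge0//.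
rewrite -ge0_integral_sum//; last by move=> q D _; rewrite lee_fin weight_on_ge0.
apply: (@le_trans _ _ (\int[iid_law nu n]_D 1)%E).
  apply: le_integral_nonmeasurable => D.
    by apply: sume_ge0 => q _; rewrite lee_fin weight_on_ge0.
  by rewrite sumEFin lee_fin sum_weight_on_le1.
by rewrite integral_probability_cst.
Qed.

Lemma integral_dominating_le x : A x ->
  (mean (dominating^~ x) <= (C * (n%:R + 1) * (2 ^+ k * c ^+ n) +
                         2 * C * (#|Y|%:R * eta ^+ k))%:E)%E.
Proof.
move=> Ax; have C0 := loss_bound_ge0.
have mx (F : sample -> input -> R) : measurable_fun setT (fun v => F v.1 v.2) ->
    measurable_fun setT (fun D => (F D x)%:E).
  move=> mF; apply/measurable_EFinP.
  exact: (measurableT_comp mF (measurable_pair2 (x : input))).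
have mtest := mx test_sparse measurable_test_sparse.
have mtrain i := mx (fun D _ => train_sparse D i) (measurable_train_sparse i).
pose M (D : sample) := \sum_z \sum_q weight_on (tuple_fst D) x q * misled_on D z q.2.
have mM : measurable_fun setT (fun D => (M D)%:E).
  apply: (mx (fun D x => \sum_z \sum_q weight_on (tuple_fst D) x q * misled_on D z q.2)).
  apply: measurable_sum => z; apply: measurable_sum => q; apply: measurable_funM.
    exact: measurable_weight_on_inputs.
  exact: measurable_misled_on.
have test0 (D : sample) : (0 <= (test_sparse D x)%:E)%E.
  by rewrite lee_fin test_sparse_ge0.
have train0 i (D : sample) : (0 <= (train_sparse D i)%:E)%E.
  by rewrite lee_fin train_sparse_ge0.
have M0 (D : sample) : (0 <= (M D)%:E)%E.
  rewrite lee_fin sumr_ge0// => z _; rewrite sumr_ge0// => q _.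
  by rewrite mulr_ge0 ?weight_on_ge0 ?misled_on_ge0.
have -> : (mean (dominating^~ x) = C%:E * (mean (test_sparse^~ x) +
    \sum_(i < n) mean (train_sparse^~ i)) + (2 * C)%:E * mean M)%E.
  have domE (D : sample) : ((dominating D x)%:E = C%:E * ((test_sparse D x)%:E +
      \sum_(i < n) (train_sparse D i)%:E) + (2 * C)%:E * (M D)%:E)%E.
    by rewrite /dominating EFinD EFinM EFinD -sumEFin [X in (_ + X)%E]EFinM.
  under eq_integral do rewrite domE.
  have mS : measurable_fun setT (fun D : sample =>
      (\sum_(i < n) (train_sparse D i)%:E)%E) by exact: emeasurable_sum.
  have S0 (D : sample) : (0 <= \sum_(i < n) (train_sparse D i)%:E)%E.
    exact: sume_ge0.
  rewrite ge0_integralD//; last 4 first.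
  - by move=> D _; rewrite mule_ge0 ?lee_fin// adde_ge0.
  - by apply: emeasurable_funM => //; exact: emeasurable_funD.
  - by move=> D _; rewrite mule_ge0 ?lee_fin ?mulr_ge0//; exact: M0.
  - by apply: emeasurable_funM.
  rewrite ge0_integralZl//; last 2 first.
  - exact: emeasurable_funD.
  - by move=> D _; rewrite adde_ge0.
  rewrite ge0_integralD// ge0_integral_sum//.
  by rewrite ge0_integralZl ?lee_fin ?mulr_ge0.
rewrite EFinD; apply: leeD; last first.
  rewrite [leRHS]EFinM; apply: lee_wpmul2l; last exact: integral_misled_le.
  by rewrite lee_fin mulr_ge0.
rewrite -mulrA [leRHS]EFinM; apply: lee_wpmul2l; first by rewrite lee_fin.
rewrite addeC mulrDl mul1r EFinD; apply: leeD; last exact: integral_test_sparse_le.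
have -> : (n%:R * (2 ^+ k * c ^+ n))%:E = (\sum_(i < n) (2 ^+ k * c ^+ n)%:E)%E.
  by rewrite sumEFin sumr_const card_ord mulr_natl.
by apply: lee_sum => i _; exact: integral_train_sparse_le.
Qed.

End dominating_function.

Section almost_everywhere_monotone.
Context {d : measure_display} {T : measurableType d} {R : realType}.
Variable m : {measure set T -> \bar R}.

Lemma aeS (P Q : T -> Prop) : (forall w, P w -> Q w) ->
  {ae m, forall w, P w} -> {ae m, forall w, Q w}.
Proof. by move=> PQ; apply: filterS. Qed.

Lemma aeS2 (P1 P2 Q : T -> Prop) : (forall w, P1 w -> P2 w -> Q w) ->
  {ae m, forall w, P1 w} -> {ae m, forall w, P2 w} -> {ae m, forall w, Q w}.
Proof. by move=> PQ; apply: filterS2. Qed.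

End almost_everywhere_monotone.

(** * Integration over the sample and the test point *)

Section expected_risk.
Context {R : realType} {X : pmetricType R} {Y : pfinType}.
Local Notation input := (borel X).
Local Notation label := (discrete Y).
Local Notation labels := (discrete {set Y}).
Hypothesis X_compact : compact [set: X].
Variables (ell : Y -> Y -> R) (C : R).
Hypothesis ell_diag : forall y, ell y y = 0.
Hypothesis ell_proper : forall z y, z != y -> 0 < ell z y.
Hypothesis ell_le : forall z y, ell z y <= C.
Variables (f : X -> Y) (A : set X) (h : R).
Hypothesis h_gt0 : 0 < h.
Hypothesis mA : measurable (A : set input).
Hypothesis f_locconst :
  forall x x', A x -> A x' -> mdist x x' < h -> f x = f x'.
Hypothesis mB : forall z, measurable (A `&` [set x | f x <> z] : set input).
Variables (mu : probability (input * label)%type R)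
  (nu : probability (input * labels)%type R).
Hypothesis mu_nu :
  forall B, measurable B -> fst_marginal mu B = fst_marginal nu B.
Hypothesis A_full : fst_marginal nu (~` (A : set input)) = 0%E.
Hypothesis mu_f : {ae mu, forall w, A w.1 /\ w.2 = f w.1}.
Hypothesis nu_f : {ae nu, forall w, A w.1 /\ f w.1 \in (w.2 : {set Y})}.
Variables (n k : nat) (p eta : R).
Hypothesis k_gt0 : (0 < k)%N.
Hypothesis p_le1 : p <= 1.
Hypothesis ball_mass : forall x, A x -> (p%:E <= fst_marginal nu (ball x h))%E.
Hypothesis eta_ge0 : 0 <= eta.
Hypothesis mislabel_thins : forall z, thins nu (mislabel f A z) eta.
Hypothesis ties : no_ties nu n.

Local Notation dom := (dominating C f A h k).

Lemma risk_eq0 : risk ell mu f = 0%E.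
Proof.
apply/eqP; rewrite eq_le; apply/andP; split; last first.
  by apply: integral_ge0 => w _; rewrite lee_fin (ell_ge0 ell_diag ell_proper).
rewrite -(integral_probability_cst mu 0%E).
have ae0 : {ae mu, forall w, ((ell (f w.1) w.2)%:E <= 0)%E}.
  by apply: aeS mu_f => w [_ <-]; rewrite ell_diag.
apply: ae_le_integral_nonmeasurable ae0 => // w.
by rewrite lee_fin (ell_ge0 ell_diag ell_proper).
Qed.

Lemma risk_le_dominating (D : n.-tuple (input * labels)) (g : X -> Y) :
  (forall i, A (inputs D i) /\ f (inputs D i) \in candidates D i) ->
  (forall i, injective (fun j => mdist (inputs D i) (inputs D j))) ->
  {ae fst_marginal nu, forall x, injective (fun j => mdist x (inputs D j))} ->
  knn_estimator ell k (inputs D) (candidates D) g ->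
  (risk ell mu g <= \int[fst_marginal nu]_x (dom D x)%:E)%E.
Proof.
move=> DA D_inj x_inj gP.
have dom0 x : (0 <= (dom D x)%:E)%E.
  by rewrite lee_fin; exact: (dominating_ge0 ell_diag ell_le).
have mdom : measurable_fun setT (fun x : input => (dom D x)%:E).
  apply/measurable_EFinP.
  exact: (measurableT_comp (measurable_dominating X_compact C h mA mB k)
    (measurable_pair1 D)).
(* [mu] and [nu] share their input marginal, so the bound can be compared with the loss almost
   everywhere under [mu], where the label is [f] of the input. *)
have -> : (\int[fst_marginal nu]_x (dom D x)%:E =
    \int[mu]_w (dom D w.1)%:E)%E.
  rewrite -(@ge0_integral_distribution _ _ _ _ _ mu fst (fun x => (dom D x)%:E))//.
  by apply: eq_measure_integral => B mB' _; exact: (esym (mu_nu mB')).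
have x_inj_mu : {ae mu, forall w, injective (fun j => mdist (w.1 : X) (inputs D j))}.
  apply: (@ae_fst_marginal _ _ _ _ _ mu
    (fun x => injective (fun j => mdist (x : X) (inputs D j)))).
  case: x_inj => N [mN N0 xN]; exists N; split => //.
  exact: etrans (mu_nu mN) N0.
have ae_le : {ae mu, forall w, ((ell (g w.1) w.2)%:E <= (dom D w.1)%:E)%E}.
  apply: aeS2 mu_f x_inj_mu => w [Aw ->] w_inj; rewrite lee_fin.
  exact: (knn_estimator_le_dominating ell_diag ell_proper ell_le h_gt0
    f_locconst k_gt0 DA D_inj Aw w_inj gP).
apply: ae_le_integral_nonmeasurable ae_le => //.
- by move=> w; rewrite lee_fin (ell_ge0 ell_diag ell_proper).
- exact: measurableT_comp mdom measurable_fst.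
Qed.

Lemma expected_risk_le (fhat : n.-tuple (input * labels) -> X -> Y) :
  knn_rule ell nu k fhat ->
  (\int[iid_law nu n]_D risk ell mu (fhat D) <=
    (C * (n%:R + 1) * (2 ^+ k * (1 - 2^-1 * p) ^+ n) +
     2 * C * (#|Y|%:R * eta ^+ k))%:E)%E.
Proof.
move=> fhatP; set K := (_ + _)%R.
have mdom := measurable_dominating X_compact C h mA mB (n := n) k.
pose F (v : n.-tuple (input * labels) * input) := (dom v.1 v.2)%:E.
have mF : measurable_fun setT F by exact/measurable_EFinP.
have F0 v : (0 <= F v)%E.
  by rewrite lee_fin; exact: (dominating_ge0 ell_diag ell_le).
apply: (@le_trans _ _ (\int[iid_law nu n]_D \int[fst_marginal nu]_x F (D, x))%E).
  have ae_le : {ae iid_law nu n, forall D, (risk ell mu (fhat D) <=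
      \int[fst_marginal nu]_x F (D, x))%E}.
    apply: aeS2 (iid_law_ae n nu_f) (aeS2 (fun D => @conj _ _) ties fhatP).
    move=> D DA [[D_inj x_inj] DP].
    exact: risk_le_dominating.
  apply: ae_le_integral_nonmeasurable ae_le.
  - move=> D; apply: integral_ge0 => w _.
    by rewrite lee_fin (ell_ge0 ell_diag ell_proper).
  - by move=> D; apply: integral_ge0 => x _; exact: F0.
  - exact: (measurable_fun_fubini_tonelli_F F).
(* The dominating function is jointly measurable, so the order can be exchanged; for each fixed test
   point in the full set [A] the sample average is at most [K]. *)
rewrite fubini_tonelli// -(integral_probability_cst (fst_marginal nu) K%:E).
have [C0 c0] : 0 <= C /\ 0 <= 1 - 2^-1 * p.
  by split; [exact: (loss_bound_ge0 ell_diag ell_le)|move: p_le1; lra].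
apply: ae_le_integral_nonmeasurable => //.
- by move=> x; apply: integral_ge0 => D _; exact: F0.
- by move=> x; rewrite lee_fin addr_ge0 ?mulr_ge0 ?addr_ge0 ?exprn_ge0.
exists (~` A); split => //; first exact: measurableC.
move=> x /=; apply: contra_not => Ax.
exact: integral_dominating_le.
Qed.

End expected_risk.

(* The triangle inequality for the norm, squared. *)
Lemma dot_le_norm {R : realType} {H : normedModType R} (ip : {dot H for idfun})
    (H_hilbert : forall u : H, `|u| = Num.sqrt (ip u u)) (u v : H) :
  ip u v <= `|u| * `|v|.
Proof.
have ip0 w : 0 <= ip w w.
  have [->|/(@neq0_dnorm_gt0 _ _ _ ip)/ltW//] := eqVneq w 0.
  by rewrite linear0r.
have sq w : `|w| ^+ 2 = ip w w by rewrite H_hilbert sqr_sqrtr.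
have ipC : ip v u = ip u v by rewrite hermC/= expr0 mul1r.
have : `|u + v| ^+ 2 <= (`|u| + `|v|) ^+ 2.
  by rewrite ler_pXn2r ?nnegrE ?addr_ge0 ?ler_normD.
rewrite sqrrD !sq linearDl/= !linearDr/= ipC => uv.
by move: uv; rewrite -mulr_natr; lra.
Qed.

(** From [2 <= e] and [1 - t <= exp (- t)], the exponent is at most [k - n p / 2 <= - n p / 4],
    which is stronger than the stated rate. *)
Lemma chernoff_factor_le {R : realType} (n k : nat) (p : R) :
  0 <= p -> p <= 1 -> k%:R <= n%:R * p / 4 ->
  2 ^+ k * (1 - 2^-1 * p) ^+ n <= expR (- (n%:R * p / 16)).
Proof.
move=> p0 p1 kn.
have two : (2 : R) ^+ k <= expR k%:R.
  rewrite -[k%:R]mulr1 expRM_natl lerXn2r ?nnegrE ?expR_ge0//.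
  exact: expR_ge1Dx.
have half : (1 - 2^-1 * p) ^+ n <= expR (n%:R * - (2^-1 * p)).
  rewrite expRM_natl lerXn2r ?nnegrE ?expR_ge0 ?expR_ge1Dx//.
  by move: p1; lra.
apply: (@le_trans _ _ (expR k%:R * expR (n%:R * - (2^-1 * p)))).
  by rewrite ler_pM ?exprn_ge0//; lra.
rewrite -expRD ler_expR; have : 0 <= n%:R * p by rewrite mulr_ge0.
by move: kn; rewrite mulrN mulrCA; lra.
Qed.

Lemma expeR_lne {R : realType} (eta : R) k :
  (0 < k)%N -> 0 <= eta -> eta < 1 ->
  expeR (- (k%:R%:E * `|lne eta%:E|))%E = (eta ^+ k)%:E.
Proof.
move=> k0; rewrite le_eqVlt => /predU1P[<- _|eta0 eta1].
  (* At [eta = 0] the logarithm is [-oo], and [k > 0] makes the product [+oo], so both sides are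
     0. *)
  by rewrite expr0n gtn_eqF// le0_lneNy//= gt0_muley ?lte_fin ?ltr0n.
rewrite lne_EFin// abse_EFin ler0_norm; last by rewrite ltW// ln_lt0// eta0.
by rewrite -EFinM -EFinN mulrN opprK/= expRM_natl lnK.
Qed.

(* The strict bound below the radius [h1] passes to [h], which may equal [h1]. *)
Lemma powR_ball_mass {R : realType} (m : R -> R) (c q h1 h : R) :
  0 < c -> 0 < q -> 0 < h -> h <= h1 -> {homo m : r s / r <= s} ->
  (forall r, 0 < r -> r < h1 -> c * r `^ q < m r) -> c * h `^ q <= m h.
Proof.
move=> c0 q0 h0 hh1 m_mono m_gt; rewrite leNgt; apply/negP => mh.
have mh0 : 0 < m h.
  apply: (@lt_le_trans _ _ (m (h / 2))); last by apply: m_mono; lra.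
  apply: le_lt_trans (m_gt _ _ _); [|lra|lra].
  by rewrite mulr_ge0 ?powR_ge0// ltW.
(* At this radius the lower bound equals [m h]. If the claim failed, [r] would lie below [h], and
   the strict bound at [r] would contradict monotonicity. *)
pose r := (m h / c) `^ q^-1.
have rq : c * r `^ q = m h.
  rewrite -powRrM mulVf ?gt_eqF// powRr1; last by rewrite divr_ge0 ?ltW.
  by rewrite mulrC divfK// gt_eqF.
have r0 : 0 < r by rewrite powR_gt0// divr_gt0.
have rh : r < h.
  rewrite ltNge; apply/negP => hr; move: mh; rewrite -rq; apply/negP.
  by rewrite -leNgt ler_pM2l// ge0_ler_powR ?nnegrE // ltW.
have := m_gt r r0 (lt_le_trans rh hh1).
by rewrite rq ltNge m_mono// ltW.
Qed.

(** The rate is fixed before [M], [N] and [e], hence is common to all estimators. It is the slower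
    of the sparsity rate [p / 16] and the mislabelling rate [L * k0]. *)
Lemma exponential_rate {R : realType} (p k0 eta : R) :
  0 < p -> 0 < k0 -> 0 <= eta -> eta < 1 ->
  exists2 c : R, 0 < c & forall (M N : R) (e : nat -> R), 0 <= M -> 0 <= N ->
    (forall n, (1 <= Num.truncn (k0 * n%:R))%N -> 0 <= e n <=
      M * (n%:R + 1) * expR (- (n%:R * p / 16))
      + N * eta ^+ Num.truncn (k0 * n%:R)) ->
    e =O_\oo (fun n : nat => n%:R * expR (- (c * n%:R))).
Proof.
move=> p0 k00 eta0 eta1.
have [L L0 etaL] : exists2 L : R, 0 < L & eta <= expR (- L).
  have [->|eta_neq0] := eqVneq eta 0; first by exists 1; rewrite ?expR_ge0.
  have eta_gt0 : 0 < eta by rewrite lt_def eta_neq0.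
  exists (- ln eta); first by rewrite oppr_gt0 ln_lt0// eta_gt0.
  by rewrite opprK lnK.
pose c := Num.min (p / 16) (L * k0).
have c0 : 0 < c by rewrite lt_min divr_gt0//= mulr_gt0.
exists c => // M N e M0 N0 e_le.
(* [2 * M] uses [n + 1 <= 2 n]; [expR L] pays for truncating [k0 * n], which loses less than 1; the
   final 1 makes the constant positive. *)
apply/eqO_exP; exists (2 * M + N * expR L + 1).
  by rewrite ltr_wpDl// addr_ge0// mulr_ge0// expR_ge0.
exists (Num.truncn k0^-1).+1 => // n /= n_large.
have nk0 : 1 <= k0 * n%:R.
  rewrite mulrC -ler_pdivrMr// mul1r; apply: ltW.
  by apply: (lt_le_trans (truncnS_gt _)); rewrite ler_nat.
have n1 : 1 <= n%:R :> R by rewrite ler1n (leq_ltn_trans _ n_large).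
have k1 : (1 <= Num.truncn (k0 * n%:R))%N.
  by rewrite truncn_gt0.
have /andP[e0 en] := e_le n k1.
have exp0 := expR_ge0 (- (c * n%:R)).
rewrite ger0_norm// ger0_norm ?mulr_ge0//; apply: le_trans en _.
have en1 : expR (- (n%:R * p / 16)) <= expR (- (c * n%:R)).
  rewrite ler_expR lerN2 -mulrA [leRHS]mulrC ler_wpM2r//.
  by rewrite ge_min lexx.
have en2 : eta ^+ Num.truncn (k0 * n%:R) <= expR L * expR (- (c * n%:R)).
  apply: (@le_trans _ _ (expR (- L) ^+ Num.truncn (k0 * n%:R))).
    by rewrite lerXn2r ?nnegrE ?expR_ge0.
  rewrite -expRM_natl -expRD ler_expR.
  have := truncnS_gt (k0 * n%:R); rewrite -natr1 => kn.
  have cL : c <= L * k0 by rewrite ge_min lexx orbT.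
  have cn : c * n%:R <= L * k0 * n%:R by rewrite ler_wpM2r.
  have Lk : L * (k0 * n%:R) <= L * ((Num.truncn (k0 * n%:R))%:R + 1).
    by rewrite ler_wpM2l// ltW.
  by move: cn Lk; rewrite mulrDr mulrA; lra.
set E := expR (- (c * n%:R)) in exp0 en1 en2 *.
have a1 : M * (n%:R + 1) * expR (- (n%:R * p / 16)) <= 2 * M * (n%:R * E).
  apply: (@le_trans _ _ (M * (n%:R + 1) * E)).
    by rewrite ler_wpM2l// mulr_ge0// addr_ge0.
  rewrite mulrA ler_wpM2r// [2 * M]mulrC -mulrA ler_wpM2l//; lra.
have a2 : N * eta ^+ Num.truncn (k0 * n%:R) <= N * expR L * (n%:R * E).
  rewrite -mulrA ler_wpM2l//; apply: le_trans en2 _.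
  by rewrite ler_wpM2l ?expR_ge0// ler_peMl.
have a3 : 0 <= n%:R * E by rewrite mulr_ge0.
by rewrite !mulrDl mul1r; lra.
Qed.

Lemma conditional_mean_dirac {R : realType} {X : pmetricType R} {Y : pfinType}
    {H : lmodType R} (kmu : R.-pker (borel X) ~> (discrete Y)) (phi : Y -> H) x z :
  kmu x [set y | y != z] = 0%E -> conditional_mean kmu phi x = phi z.
Proof.
move=> kz; rewrite /conditional_mean (bigD1 z)//= big1 ?addr0 => [|y yz].
  have -> : kmu x [set z] = 1%E; last by rewrite scale1r.
  have kT : kmu x setT = (kmu x [set z] + kmu x [set y | (y != z)%B])%E.
    apply: etrans (measureU _ _ _ _) => //.
      congr (kmu x _); apply/seteqP; split => // y _.
      by have [->|yz] := eqVneq y z; [left|right].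
    by apply/seteqP; split => // y [->] /=; rewrite eqxx.
  by have := prob_kernel (s := kmu) x; rewrite kT kz adde0.
have -> : kmu x [set y] = 0%E; last by rewrite scale0r.
have : (kmu x [set y] <= kmu x [set y' | y' != z])%E.
  by apply: le_measure; rewrite ?inE// => _ ->.
by rewrite kz measure_le0 => /eqP.
Qed.

Lemma norm_le_sup_range {R : realType} {Y : finType} {H : normedModType R}
    (g : Y -> H) y : `|g y| <= sup (range (fun y => `|g y|)).
Proof.
apply: ub_le_sup; last by exists y.
exists (\sum_z `|g z|) => _ [z _ <-].
by rewrite (bigD1 z)//= lerDl sumr_ge0.
Qed.

(** * Separation of the labels, finite-sample bound and exponential rate *)

Theorem theorem4 (R : realType) (X : pmetricType R) (Y : pfinType)
  (X_compact : compact [set: X])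
  (ell : Y -> Y -> R)
  (ell_diag : forall y, ell y y = 0)
  (ell_proper : forall z y, z != y -> 0 < ell z y)
  (H : completeNormedModType R) (ip : {dot H for idfun})
  (H_hilbert : forall u : H, `|u| = Num.sqrt (ip u u))
  (H_separable : exists2 C : set H, countable C & dense C)
  (phi psi : Y -> H)
  (ell_ip : forall z y, ell z y = ip (psi z) (phi y))
  (nu : probability (borel X * discrete {set Y})%type R)
  (knu : R.-pker (borel X) ~> (discrete {set Y}))
  (knuP : conditional_law nu knu)
  (mu : probability (borel X * discrete Y)%type R)
  (kmu : R.-pker (borel X) ~> (discrete Y))
  (muP : optimal_disambiguation ell nu knu mu kmu)
  (fstar : X -> Y)
  (fstarP : optimal_predictor ell (fst_marginal nu) kmu fstar)
  (ties : forall n, no_ties nu n)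
  (h1 c_mu q : R) (h1_gt0 : 0 < h1) (c_mu_gt0 : 0 < c_mu) (q_gt0 : 0 < q)
  (mass : forall (x : X) (r : R), msupport (fst_marginal nu) x ->
     0 < r -> r < h1 -> ((c_mu * r `^ q)%:E < fst_marginal nu (ball x r))%E)
  (eta : R) (eta_ge0 : 0 <= eta) (eta_lt1 : eta < 1)
  (nonambiguity : forall x : X, msupport (fst_marginal nu) x ->
     exists2 y : Y, knu x [set s : {set Y} | y \in s] = 1%E &
       forall z : Y, z != y ->
         (knu x [set s : {set Y} | z \in s] <= eta%:E)%E)
  (c_g : R) (c_g_gt0 : 0 < c_g)
  (g_lipschitz : forall x x' : X,
     `|conditional_mean kmu phi x - conditional_mean kmu phi x'|
       <= c_g * mdist x x') :
  let c_psi := sup (range (fun z : Y => `|psi z|)) in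
  let c_phi := sup (range (fun y : Y => `|phi y|)) in
  let separated (h2 : R) := forall x x' : X,
    msupport (fst_marginal nu) x -> msupport (fst_marginal nu) x' ->
    fstar x <> fstar x' -> h2 < mdist x x' in
  (exists2 h2 : R, 0 < h2 & separated h2) /\
  forall h2 : R, 0 < h2 -> separated h2 ->
  let h := Num.min h1 h2 in
  let p := c_mu * h `^ q in
  (forall (n k : nat)
          (fhat : n.-tuple (borel X * discrete {set Y})%type -> X -> Y),
     (1 <= k)%N -> k%:R < n%:R * p / 4 -> knn_rule ell nu k fhat ->
     (excess_risk ell nu mu fstar fhat
       <= (8 * c_psi * c_phi * (n%:R + 1) * expR (- (n%:R * p / 16)))%:E
        + (8 * c_psi * c_phi * #|Y|%:R)%:E
          * expeR (- (k%:R%:E * `|lne eta%:E|)))%E) /\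
  (forall k0 : R, 0 < k0 -> k0 < p / 4 ->
     exists2 c : R, 0 < c &
       forall fhat : forall n : nat,
           n.-tuple (borel X * discrete {set Y})%type -> X -> Y,
         (forall n, (1 <= Num.truncn (k0 * n%:R))%N ->
            knn_rule ell nu (Num.truncn (k0 * n%:R)) (fhat n)) ->
         (fun n : nat => fine (excess_risk ell nu mu fstar (fhat n)))
           =O_\oo (fun n : nat => n%:R * expR (- (c * n%:R)))).
Proof.
move=> c_psi c_phi separated.
pose nuX := fst_marginal nu; pose A : set X := msupport nuX.
have [mu_compat mu_law mu_min] := muP.
have pt x : A x -> [/\ kmu x [set y | y != fstar x] = 0%E,
    knu x [set s : {set Y} | fstar x \in s] = 1%E &
    forall z, z != fstar x -> (knu x [set s : {set Y} | z \in s] <= eta%:E)%E].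
  move=> Ax; have [y y1 yeta] := nonambiguity x Ax.
  have [-> ?] := pointwise_optimum ell_diag ell_proper (prob_kernel (s := knu) x) y1 eta_lt1
    yeta (mu_min x Ax) (fstarP x Ax).
  by split.
have phi_neq y y' : y != y' -> phi y != phi y'.
  move=> /[dup] yy' /ell_proper; rewrite ell_ip; apply: contraTneq => <-.
  by rewrite -ell_ip ell_diag ltxx.
have ipg x : A x -> conditional_mean kmu phi x = phi (fstar x).
  by move=> /pt[/conditional_mean_dirac ->].
split.
  (* The least distance between embedded labels, capped at 1, which is also its value when there is
     a single label. Halving [delta / c_g] below makes the separation strict. *)
  pose delta := \big[Order.min/1]_(q : Y * Y | q.1 != q.2) `|phi q.1 - phi q.2|.
  have delta0 : 0 < delta.
    apply: (big_ind (fun d : R => 0 < d)) => [|a b a0 b0|q0 q12] //; first by rewrite lt_min a0.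
    by rewrite normr_gt0 subr_eq0 phi_neq.
  exists (delta / (2 * c_g)); first by rewrite divr_gt0// mulr_gt0.
  move=> x x' Ax Ax' /eqP fx.
  have : delta <= `|phi (fstar x) - phi (fstar x')|.
    exact: (@bigmin_le_cond _ _ _ _ (fstar x, fstar x')).
  rewrite ltr_pdivrMr ?mulr_gt0// -!ipg// => dx.
  have := g_lipschitz x x'; have := mdist_ge0 x x'; move: dx delta0; nra.
move=> h2 h2_gt0 h2_sep h p.
have h_gt0 : 0 < h by rewrite lt_min h1_gt0.
have f_loc x x' : A x -> A x' -> mdist x x' < h -> fstar x = fstar x'.
  move=> Ax Ax'; rewrite lt_min => /andP[_ xh2]; apply: contrapT => fx.
  by have := h2_sep x x' Ax Ax' fx; rewrite ltNge (ltW xh2).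
have cA : closed A := @closed_msupport _ _ _.
have mA : measurable (A : set (borel X)).
  by rewrite -[A]setCK; apply: measurableC; apply: measurable_open; exact: closed_openC.
(* [fstar] is an arbitrary pointwise selection; its measurability on the support comes from local
   constancy. *)
have mlevel y : measurable (A `&` [set x | fstar x = y] : set (borel X)).
  rewrite -[_ `&` _]setCK; apply: measurableC; apply: measurable_open.
  by apply: closed_openC; exact: closed_locconst_level h_gt0 cA f_loc.
have mB z : measurable (A `&` [set x | fstar x <> z] : set (borel X)).
  rewrite (_ : _ `&` _ = A `\` (A `&` [set x | fstar x = z])).
    exact: measurableD.
  apply/seteqP; split => x [Ax fx]; split => //; first by case.
  by move=> fz; apply: fx.
have A_full : nuX (~` (A : set (borel X))) = 0%E by exact: msupport_full.
have mu_nu B : measurable B -> fst_marginal mu B = nuX B.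
  case: mu_compat => pi [pi1 pi2 _] mB'.
  have mfst d (S : measurableType d) : measurable (fst @^-1` B : set (borel X * S)).
    by rewrite -[_ @^-1` _]setTI; exact: measurable_fst.
  rewrite /nuX /fst_marginal /= /pushforward.
  exact: etrans (esym (pi1 _ (mfst _ _))) (pi2 _ (mfst _ _)).
have mu_f : {ae mu, forall w, A w.1 /\ w.2 = fstar w.1}.
  apply: (conditional_law_ae mu_law (C := fun y => [set y])) => // [|x /pt[kx _ _]].
    by apply: etrans (mu_nu _ _) A_full; exact: measurableC.
  by apply: etrans kx; congr (kmu x _); apply/seteqP; split => y /= /eqP.
have nu_f : {ae nu, forall w, A w.1 /\ fstar w.1 \in (w.2 : {set Y})}.
  apply: (conditional_law_ae knuP (C := fun y => [set s : {set Y} | y \in s])) => //.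
  by move=> x /pt[_ kx _]; apply: measure_setC_eq0 kx => //; exact: prob_kernel.
have thin z : thins nu (mislabel fstar A z) eta.
  apply: (conditional_law_thins knuP) => // x [/pt[_ _ keta] /eqP fz].
  by apply: keta; rewrite eq_sym.
have mball (x : X) r : measurable (ball x r : set (borel X)).
  by apply: measurable_open; exact: open_mball.
have mass_h x : A x -> (p%:E <= nuX (ball x h))%E.
  move=> Ax; pose m r := fine (nuX (ball x r)).
  have mE r : nuX (ball x r) = (m r)%:E by rewrite fineK// fin_num_measure.
  rewrite mE lee_fin; apply: (powR_ball_mass (h1 := h1)) => //.
  - by rewrite ge_min lexx.
  - move=> r s rs; rewrite -lee_fin -!mE le_measure ?inE//.
    by move=> y; rewrite !ballEmdist/= => /lt_le_trans; exact.
  - by move=> r r0 rh1; rewrite -lte_fin -mE; exact: mass.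
have p_gt0 : 0 < p by rewrite mulr_gt0// powR_gt0.
have p_le1 : p <= 1.
  (* The support has full mass, hence contains a point, whose ball has mass between [p] and 1. *)
  have [x Ax] : A !=set0.
    apply/set0P/eqP => A0; move: A_full; rewrite A0 setC0 probability_setT.
    by move=> /eqP; rewrite onee_eq0.
  by rewrite -lee_fin; apply: le_trans (mass_h x Ax) _; exact: probability_le1.
have psi0 : 0 <= c_psi by exact: le_trans (norm_le_sup_range psi point).
have phi0 : 0 <= c_phi by exact: le_trans (norm_le_sup_range phi point).
pose C := c_psi * c_phi.
have C0 : 0 <= C by exact: mulr_ge0.
have ell_le z y : ell z y <= C.
  rewrite ell_ip (le_trans (dot_le_norm H_hilbert _ _))//.
  by rewrite ler_pM//; exact: norm_le_sup_range.
have excess_ge0 n (fhat : n.-tuple (borel X * discrete {set Y})%type -> X -> Y) :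
    (0 <= excess_risk ell nu mu fstar fhat)%E.
  rewrite /excess_risk (risk_eq0 ell_diag ell_proper mu_f) sube0.
  apply: integral_ge0 => D _; apply: integral_ge0 => w _.
  by rewrite lee_fin (ell_ge0 ell_diag ell_proper).
have excess_le n k (fhat : n.-tuple (borel X * discrete {set Y})%type -> X -> Y) :
    (1 <= k)%N -> k%:R < n%:R * p / 4 -> knn_rule ell nu k fhat ->
    (excess_risk ell nu mu fstar fhat <=
      (8 * C * (n%:R + 1) * expR (- (n%:R * p / 16)) + 8 * C * #|Y|%:R * eta ^+ k)%:E)%E.
  move=> k1 kn fhatP.
  rewrite /excess_risk (risk_eq0 ell_diag ell_proper mu_f) sube0.
  apply: le_trans (expected_risk_le X_compact ell_diag ell_proper ell_le h_gt0 mA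
    f_loc mB mu_nu A_full mu_f nu_f k1 p_le1 mass_h eta_ge0 thin (ties n) fhatP) _.
  have chernoff := chernoff_factor_le (ltW p_gt0) p_le1 (ltW kn).
  have Cn0 : 0 <= C * (n%:R + 1) by rewrite mulr_ge0 ?addr_ge0.
  have exp0 := expR_ge0 (- (n%:R * p / 16)).
  have Ceta0 : 0 <= C * (#|Y|%:R * eta ^+ k).
    by rewrite !mulr_ge0 ?exprn_ge0.
  (* The integrated bound carries the constants [C] and [2 * C]; both are relaxed to [8 * C]. *)
  have := ler_wpM2l Cn0 chernoff; have := mulr_ge0 Cn0 exp0.
  by rewrite lee_fin -!mulrA in Ceta0 *; lra.
split.
  move=> n k fhat k1 kn fhatP; rewrite expeR_lne// -EFinM -EFinD.
  by rewrite -!(mulrA 8 c_psi); exact: excess_le.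
move=> k0 k0_gt0 k0p.
have [c c0 cP] := exponential_rate p_gt0 k0_gt0 eta_ge0 eta_lt1.
exists c => // fhat fhatP.
apply: (cP (8 * C) (8 * C * #|Y|%:R)); rewrite ?mulr_ge0// => n k1.
have kn : (Num.truncn (k0 * n%:R))%:R < n%:R * p / 4.
  have /andP[kle _] := truncn_itv (mulr_ge0 (ltW k0_gt0) (ler0n R n)).
  have n_gt0 : 0 < n%:R :> R.
    (* A positive neighbor count forces [n > 0], which keeps the inequality strict when [k0 < p / 4]
       is multiplied by [n]. *)
    rewrite ltr0n lt0n; apply: contraTneq k1 => ->.
    by rewrite mulr0 truncn0.
  apply: le_lt_trans kle _; by rewrite -mulrA mulrC ltr_pM2l.
(* The excess risk lies between 0 and a real number, so it is finite and [fine] preserves both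
   bounds. *)
have := excess_le n _ (fhat n) k1 kn (fhatP n k1); have := excess_ge0 n (fhat n).
by case: (excess_risk _ _ _ _ _) => //= r; rewrite !lee_fin => -> ->.
Qed.
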